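(* Let $\psi\in W_0^{1,p}(\Omega)$ and $f\in L^{p'}(\Omega)$. Then the variational inequality $$u\in K(\psi),\qquad \int_\Omega |\nabla u|^{p-2}\nabla u\cdot\nabla(v-u)\,dx\ \ge\ \int_\Omega f(v-u)\,dx\quad\text{for all } v\in K(\psi)$$ possesses a unique solution $u$.
   Context: $\Omega\subset\mathbb{R}^N$, $N\ge 2$, is a bounded domain whose boundary is piecewise $\mathcal C^1$; $1<p<\infty$ and $p'$ is the conjugate exponent of $p$. For $\psi\in W_0^{1,p}(\Omega)$ (the obstacle), $K(\psi)=\{v\in W_0^{1,p}(\Omega): v\ge\psi \text{ a.e. in }\Omega\}$. *)

(* Defs.v *)
From HB Require Import structures.
From mathcomp Require Import all_boot all_order all_algebra.
From mathcomp Require Import all_classical all_reals all_analysis.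

Set Implicit Arguments.
Unset Strict Implicit.
Unset Printing Implicit Defensive.

Import Order.TTheory GRing.Theory Num.Theory.
Import numFieldNormedType.Exports.

Local Open Scope classical_set_scope.
Local Open Scope ring_scope.

(* R^n is 'rV[R]_n. Its sigma-algebra is the one generated by the coordinate
   maps, i.e. the Borel sigma-algebra. *)
Section measurable_rV.
Context (R : realType) (n : nat).

Definition rV_coord (i : 'I_n) (v : 'rV[R]_n) : measurableTypeR R := v ord0 i.

Let rV_set0 : g_sigma_preimage rV_coord set0.
Proof. exact: sigma_algebra0. Qed.

Let rV_setC A : g_sigma_preimage rV_coord A -> g_sigma_preimage rV_coord (~` A).
Proof. exact: sigma_algebraC. Qed.

Let rV_bigcup (F : (set 'rV[R]_n)^nat) :
  (forall i, g_sigma_preimage rV_coord (F i)) ->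
  g_sigma_preimage rV_coord (\bigcup_i F i).
Proof. exact: sigma_algebra_bigcup. Qed.

HB.instance Definition _ := @isMeasurable.Build default_measure_display
  'rV[R]_n (g_sigma_preimage rV_coord) rV_set0 rV_setC rV_bigcup.

Lemma measurable_rV_coord (i : 'I_n) : measurable_fun [set: 'rV[R]_n] (rV_coord i).
Proof.
move=> _ Y mY; rewrite setTI; apply: sub_sigma_algebra => /=.
rewrite -bigcup_seq/=; exists i => /=; first by rewrite mem_index_enum.
by exists Y => //; rewrite setTI.
Qed.

Lemma measurable_fun_rVP d (T : measurableType d) (f : T -> 'rV[R]_n) :
  (forall i, measurable_fun [set: T] (rV_coord i \o f)) ->
  measurable_fun [set: T] f.
Proof.
move=> mf; suff h : g_sigma_preimage (fun i => rV_coord i \o f) `<=` measurable.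
  move=> _ A mA; rewrite setTI; apply: h; rewrite g_sigma_preimage_comp.
  by exists A => //; rewrite setTI.
apply: smallest_sub; first exact: sigma_algebra_measurable.
rewrite -bigcup_seq => A [i _ [B mB <-]].
by rewrite setTI; have := mf i measurableT B mB; rewrite setTI.
Qed.

End measurable_rV.

(* Lebesgue measure on R^n, by recursion on n: up to the identification of
   R^(n+1) with R x R^n, it is the product of the Lebesgue measures of R and
   R^n. *)
Section lebesgue_rV.
Context (R : realType).

Definition rV_cons n (x : measurableTypeR R * 'rV[R]_n) : 'rV[R]_n.+1 :=
  row_mx (x.1 : R)%:M x.2.

Definition rV_uncons n (v : 'rV[R]_n.+1) : measurableTypeR R * 'rV[R]_n :=
  (v ord0 ord0, \row_j v ord0 (lift ord0 j)).

Lemma rV_cons0 n (x : measurableTypeR R * 'rV[R]_n) :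
  rV_cons x ord0 ord0 = x.1.
Proof.
have -> : (ord0 : 'I_n.+1) = lshift n (ord0 : 'I_1) by exact: val_inj.
by rewrite (row_mxEl (x.1 : R)%:M x.2) mxE mulr1n.
Qed.

Lemma rV_consS n (x : measurableTypeR R * 'rV[R]_n) j :
  rV_cons x ord0 (lift ord0 j) = x.2 ord0 j.
Proof.
have -> : lift (ord0 : 'I_n.+1) j = rshift 1 j by exact: val_inj.
by rewrite (row_mxEr (x.1 : R)%:M x.2).
Qed.

Lemma rV_consK n : cancel (@rV_cons n) (@rV_uncons n).
Proof.
move=> [a v]; rewrite /rV_uncons rV_cons0; congr pair.
by apply/rowP => j; rewrite mxE rV_consS.
Qed.

Lemma rV_unconsK n : cancel (@rV_uncons n) (@rV_cons n).
Proof.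
move=> v; apply/rowP => i; case: (unliftP ord0 i) => [j|] ->.
  by rewrite rV_consS mxE.
by rewrite rV_cons0.
Qed.

Lemma measurable_rV_cons n : measurable_fun setT (@rV_cons n).
Proof.
apply: measurable_fun_rVP => i; case: (unliftP ord0 i) => [j|] ->.
  rewrite (_ : _ \o _ = @rV_coord R n j \o snd).
    by apply: measurableT_comp => //; exact: measurable_rV_coord.
  by apply/funext => x /=; rewrite /rV_coord rV_consS.
rewrite (_ : _ \o _ = fst)//.
by apply/funext => x /=; rewrite /rV_coord rV_cons0.
Qed.

Lemma measurable_rV_uncons n : measurable_fun setT (@rV_uncons n).
Proof.
apply: measurable_fun_pair; first exact: measurable_rV_coord.
apply: measurable_fun_rVP => j.
rewrite (_ : _ \o _ = @rV_coord R n.+1 (lift ord0 j)).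
  exact: measurable_rV_coord.
by apply/funext => v /=; rewrite /rV_coord mxE.
Qed.

Section step.
Context (n : nat) (m : {sigma_finite_measure set 'rV[R]_n -> \bar R}).

Definition lebesgue_rV_step : set 'rV[R]_n.+1 -> \bar R :=
  pushforward (lebesgue_measure \x m)%E (@rV_cons n).

Let step_pre A : measurable A -> measurable (@rV_cons n @^-1` A).
Proof.
by move=> mA; rewrite -[X in measurable X]setTI; exact: measurable_rV_cons.
Qed.

Let step0 : lebesgue_rV_step set0 = 0%E.
Proof. by rewrite /lebesgue_rV_step /pushforward preimage_set0 measure0. Qed.

Let step_ge0 A : (0 <= lebesgue_rV_step A)%E.
Proof. by rewrite /lebesgue_rV_step /pushforward measure_ge0. Qed.

Let step_sigma_additive : semi_sigma_additive lebesgue_rV_step.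
Proof.
move=> F mF tF mUF; rewrite /lebesgue_rV_step /pushforward preimage_bigcup.
apply: measure_semi_sigma_additive.
- by move=> i; exact: step_pre.
- apply/trivIsetP => /= i j _ _ ij; rewrite -preimage_setI.
  by move/trivIsetP : tF => /(_ _ _ _ _ ij) ->//; rewrite preimage_set0.
- by rewrite -preimage_bigcup; exact: step_pre.
Qed.

HB.instance Definition _ := isMeasure.Build _ _ _ lebesgue_rV_step
  step0 step_ge0 step_sigma_additive.

Let step_sigma_finite : sigma_finite [set: 'rV[R]_n.+1] lebesgue_rV_step.
Proof.
have /sigma_finiteP[F [TF ndF Foo]] := sigma_finiteT (@lebesgue_measure R).
have /sigma_finiteP[G [TG ndG Goo]] := sigma_finiteT m.
exists (fun i => @rV_uncons n @^-1` (F i `*` G i)).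
  rewrite -preimage_bigcup (_ : \bigcup_i _ = setT) ?preimage_setT//.
  apply/seteqP; split => // -[x y] _.
  have [i _ Fx] : (\bigcup_i F i) x by rewrite -TF.
  have [j _ Gy] : (\bigcup_i G i) y by rewrite -TG.
  exists (maxn i j) => //; split => /=.
  - by move: x Fx; exact/subsetPset/ndF/leq_maxl.
  - by move: y Gy; exact/subsetPset/ndG/leq_maxr.
move=> i; have [mF Fioo] := Foo i; have [mG Gioo] := Goo i; split.
  rewrite -[X in measurable X]setTI; apply: measurable_rV_uncons => //.
  exact: measurableX.
rewrite /lebesgue_rV_step /pushforward -comp_preimage.
rewrite (_ : _ \o _ = id); last by apply/funext => x /=; rewrite rV_consK.
by rewrite preimage_id product_measure1E// lte_mul_pinfty// ge0_fin_numE.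
Qed.

HB.instance Definition _ := Measure_isSigmaFinite.Build _ _ _
  lebesgue_rV_step step_sigma_finite.

End step.

Fixpoint lebesgue_rV n : {sigma_finite_measure set 'rV[R]_n -> \bar R} :=
  match n with
  | 0 => dirac (0 : 'rV[R]_0)
  | n'.+1 => lebesgue_rV_step (lebesgue_rV n')
  end.

Lemma lebesgue_rV_box n (A : 'I_n -> set (measurableTypeR R)) :
  (forall i, measurable (A i)) ->
  lebesgue_rV n [set v | forall i, A i (v ord0 i)] =
  (\prod_(i < n) lebesgue_measure (A i))%E.
Proof.
elim: n A => [|n IH] A mA.
  rewrite big_ord0 /= diracE mem_set//=.
  by case.
have mB : measurable [set v : 'rV[R]_n | forall i, A (lift ord0 i) (v ord0 i)].
  rewrite (_ : mkset _ = \bigcap_(i in [set: 'I_n])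
      (@rV_coord R n i @^-1` A (lift ord0 i))).
    apply: fin_bigcap_measurable => // i _.
    by rewrite -[X in measurable X]setTI; exact: measurable_rV_coord.
  by apply/seteqP; split => v /= h i; [move=> _; exact: h|exact: (h i I)].
rewrite big_ord_recl -IH// /= /lebesgue_rV_step /pushforward /=.
rewrite -product_measure1E//; congr (_ _).
apply/seteqP; split => [x h|x [h0 h] i] /=.
  split => [|i]; first by have := h ord0; rewrite rV_cons0.
  by have := h (lift ord0 i); rewrite rV_consS.
by case: (unliftP ord0 i) => [j|] ->; rewrite ?rV_cons0 ?rV_consS.
Qed.

End lebesgue_rV.

Section euclidean.
Context (R : realType) (N : nat).
Implicit Types a b : 'rV[R]_N.

Definition edot a b : R := \sum_i a ord0 i * b ord0 i.

(* The library norm `|a| on 'rV[R]_N is the sup norm. *)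
Definition enorm a : R := Num.sqrt (edot a a).

(* |a|^(p-2) a, whose value at a = 0 is 0 for every p. *)
Definition pflux (p : R) a : 'rV[R]_N := (enorm a `^ (p - 2)) *: a.

End euclidean.

Section smooth.
Context (R : realType) (N : nat).
Implicit Types (g : 'rV[R]_N -> R) (U : set 'rV[R]_N).

Definition partial (i : 'I_N) g : 'rV[R]_N -> R := 'D_(delta_mx ord0 i) g.

Definition gradient g (x : 'rV[R]_N) : 'rV[R]_N := \row_i partial i g x.

Definition C1_on U g := forall x, U x -> forall i,
  derivable g x (delta_mx ord0 i) /\ {for x, continuous (partial i g)}.

(* foldr partial g [:: i1; ..; ik] is the k-th order derivative
   d_i1 .. d_ik g. *)
Definition smooth g := forall s : seq 'I_N,
  continuous (foldr partial g s) /\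
  forall x i, derivable (foldr partial g s) x (delta_mx ord0 i).

Definition supp g : set 'rV[R]_N := closure [set x | g x != 0].

Definition test_function U g :=
  [/\ smooth g, compact (supp g) & supp g `<=` U].

End smooth.

Section domains.
Context (R : realType) (N : nat).
Implicit Types (U S Omega : set 'rV[R]_N).

Definition domain Omega := [/\ open Omega, connected Omega & Omega !=set0].

Definition boundary U := closure U `\` U°.

(* Points in a neighbourhood of which S is an embedded C^1 hypersurface. *)
Definition C1_points S : set 'rV[R]_N := [set x | exists U g,
  [/\ open_nbhs x U, C1_on U g, forall y, U y -> gradient g y != 0 &
      S `&` U = [set y | g y = 0] `&` U]].

(* Vanishing (N-1)-dimensional Hausdorff measure, for N >= 2: the radii need no
   explicit bound since each term of the series is at most e. *)
Definition hausdorff_null S := forall e : R, 0 < e ->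
  exists (c : nat -> 'rV[R]_N) (r : nat -> R),
    [/\ forall k, 0 <= r k, S `<=` \bigcup_k ball (c k) (r k) &
        (\sum_(0 <= k <oo) (r k ^+ N.-1)%:E <= e%:E)%E].

(* The boundary consists of C^1 hypersurfaces, up to a singular set (edges,
   corners, conical points) of vanishing (N-1)-dimensional measure. *)
Definition piecewise_C1_boundary Omega :=
  hausdorff_null (boundary Omega `\` C1_points (boundary Omega)).

End domains.

Section sobolev.
Context (R : realType) (N : nat).
Local Notation mu := (@lebesgue_rV R N).
Local Notation E := 'rV[R]_N.

(* L^p(Omega), through the extension of f by 0 outside Omega. *)
Definition Lp (p : \bar R) (Omega : set E) : set (E -> R) :=
  [set f | f \_ Omega \in Lfun mu p].

Definition weak_gradient (Omega : set E) (u : E -> R) (G : E -> E) :=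
  forall phi, test_function Omega phi -> forall i,
    \int[mu]_(x in Omega) (u x * partial i phi x) =
    - \int[mu]_(x in Omega) (G x ord0 i * phi x).

(* W^{1,p}(Omega): an element is given by (a representative of) a function
   together with (a representative of) its weak gradient, which the function
   determines almost everywhere. *)
Record sobolev (p : R) (Omega : set E) := Sobolev {
  sobolev_fun :> E -> R;
  grad : E -> E;
  sobolev_fun_Lp : Lp p%:E Omega sobolev_fun;
  grad_Lp : forall i, Lp p%:E Omega (fun x => grad x ord0 i);
  gradP : weak_gradient Omega sobolev_fun grad
}.

Definition sobolev_norm (p : R) (Omega : set E) (u : E -> R) (G : E -> E) :
    \bar R :=
  ('N[mu]_(p%:E)[EFin \o (u \_ Omega)] +
   \sum_(i < N) 'N[mu]_(p%:E)[EFin \o ((fun x => G x ord0 i) \_ Omega)])%E.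

(* W_0^{1,p}(Omega): the closure of the test functions in W^{1,p}(Omega). *)
Definition W0 (p : R) (Omega : set E) : set (sobolev p Omega) :=
  [set u : sobolev p Omega |
    exists2 phi : nat -> E -> R, forall k, test_function Omega (phi k) &
    sobolev_norm p Omega (fun x => phi k x - u x)
      (fun x => gradient (phi k) x - grad u x) @[k --> \oo] --> 0%E].

Definition obstacle_set (p : R) (Omega : set E) (psi : E -> R) :
    set (sobolev p Omega) :=
  [set v : sobolev p Omega | W0 v /\ (\forall x \ae mu, Omega x -> psi x <= v x)].

(* grad v - grad u is the weak gradient of v - u. *)
Definition obstacle_solution (p : R) (Omega : set E) (f psi : E -> R)
    (u : sobolev p Omega) :=
  obstacle_set psi u /\
  forall v : sobolev p Omega, obstacle_set psi v ->
    \int[mu]_(x in Omega) edot (pflux p (grad u x)) (grad v x - grad u x) >=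
    \int[mu]_(x in Omega) (f x * (v x - u x)).

End sobolev.

(* Main.v *)
Require Import Defs.
From HB Require Import structures.
From mathcomp Require Import all_boot all_order all_algebra.
From mathcomp Require Import all_classical all_reals all_analysis.
From mathcomp Require Import measurable_realfun.
From mathcomp Require Import ring lra.

(** The solution is the minimizer of
    [J v = 1/p * \int |grad v| ^ p - \int f v] over the admissible functions,
    found by the direct method without weak compactness. For every [p > 1] the
    function [|.| ^ p] on [R^N] is uniformly convex ([uniform_convexity]):
    [|a - b| ^ p] is bounded by a small multiple of [|a| ^ p + |b| ^ p] plus a
    multiple of the deficit in midpoint convexity. Integrated, this shows that
    two admissible functions whose energies are both close to the infimum have
    close gradients ([near_minimizers_close]), because the midpoint is
    admissible too. Minimizing sequences are therefore strongly Cauchy.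

    The Poincare inequality ([poincare_W0]) carries this over to the functions
    themselves, and makes [J] bounded below and coercive
    ([obstacle_energy_coercive]). It is proved for test functions on lines,
    by the fundamental theorem of calculus, Jensen's inequality and Tonelli's
    theorem. Completeness of the space of Sobolev functions
    ([sobolev_complete]) rests on [LpOn_complete]: a fast Cauchy sequence
    converges almost everywhere, and Fatou's lemma controls the distance to the
    limit. Almost everywhere convergence preserves the obstacle constraint.

    Minimizers and solutions are related by one inequality: [|.| ^ p] lies
    above its tangents, whose slope is the flux [|a| ^ (p - 2) a] up to the
    factor [p] ([pflux_subgradient], [obstacle_energy_subgradient]). It shows
    that the limit of the minimizing sequence is a minimizer
    ([minimizer_exists]), that solutions are minimizers ([solution_minimizes]),
    and, applied along segments, that minimizers are solutions
    ([minimizer_solves]). Uniqueness follows since two minimizers have equal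
    gradients, hence are equal by the Poincare inequality
    ([minimizer_unique]). *)

Set Implicit Arguments.
Unset Strict Implicit.
Unset Printing Implicit Defensive.

Import Order.TTheory GRing.Theory Num.Theory.
Import numFieldNormedType.Exports.

Local Open Scope classical_set_scope.
Local Open Scope ring_scope.

(** * Euclidean geometry *)

Section edot_theory.
Context (R : realType) (N : nat).
Implicit Types (a b c : 'rV[R]_N) (k : R).

Lemma edotC a b : edot a b = edot b a.
Proof. by apply: eq_bigr => i _; rewrite mulrC. Qed.

Lemma edotDl a b c : edot (a + b) c = edot a c + edot b c.
Proof. by rewrite -big_split; apply: eq_bigr => i _; rewrite mxE mulrDl. Qed.

Lemma edotZl k a b : edot (k *: a) b = k * edot a b.
Proof. by rewrite mulr_sumr; apply: eq_bigr => i _; rewrite mxE mulrA. Qed.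

Lemma edotDr a b c : edot a (b + c) = edot a b + edot a c.
Proof. by rewrite ![edot a _]edotC edotDl. Qed.

Lemma edotZr k a b : edot a (k *: b) = k * edot a b.
Proof. by rewrite ![edot a _]edotC edotZl. Qed.

Lemma edotNl a b : edot (- a) b = - edot a b.
Proof. by rewrite -scaleN1r edotZl mulN1r. Qed.

Lemma edotNr a b : edot a (- b) = - edot a b.
Proof. by rewrite edotC edotNl edotC. Qed.

Definition edotE := (edotDl, edotDr, edotZl, edotZr, edotNl, edotNr).

Lemma edot_ge0 a : 0 <= edot a a.
Proof. by apply: sumr_ge0 => i _; rewrite -expr2 sqr_ge0. Qed.

Lemma enorm_ge0 a : 0 <= enorm a.
Proof. exact: sqrtr_ge0. Qed.

Lemma sqr_enorm a : enorm a ^+ 2 = edot a a.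
Proof. by rewrite sqr_sqrtr// edot_ge0. Qed.

Lemma enorm0 : enorm (0 : 'rV[R]_N) = 0.
Proof. by rewrite /enorm -(scale0r 0) edotZl mul0r sqrtr0. Qed.

Lemma ler_coord_enorm a i : `|a ord0 i| <= enorm a.
Proof.
rewrite -sqrtr_sqr ler_wsqrtr// expr2 /edot (bigD1 i)//= lerDl.
by apply: sumr_ge0 => j _; rewrite -expr2 sqr_ge0.
Qed.

Lemma enorm_eq0 a : enorm a = 0 -> a = 0.
Proof.
move=> a0; apply/rowP => i; rewrite mxE; apply/eqP.
by rewrite -normr_le0 -a0 ler_coord_enorm.
Qed.

Lemma enormZ k a : enorm (k *: a) = `|k| * enorm a.
Proof.
by rewrite /enorm edotZl edotZr mulrA -expr2 sqrtrM ?sqr_ge0// sqrtr_sqr.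
Qed.

Lemma enormN a : enorm (- a) = enorm a.
Proof. by rewrite -scaleN1r enormZ normrN1 mul1r. Qed.

Lemma edot_le_enorm a b : edot a b <= enorm a * enorm b.
Proof.
have [a0|a0] := eqVneq (enorm a) 0.
  by rewrite a0 mul0r (enorm_eq0 a0) -(scale0r 0) edotZl mul0r.
have [b0|b0] := eqVneq (enorm b) 0.
  by rewrite b0 mulr0 (enorm_eq0 b0) -(scale0r 0) edotZr mul0r.
have := edot_ge0 (enorm b *: a - enorm a *: b).
rewrite !edotE -!sqr_enorm (edotC b a) => h.
have ab : 0 < enorm a * enorm b by rewrite mulr_gt0// lt0r ?a0 ?b0 enorm_ge0.
rewrite -(ler_pM2l ab); nra.
Qed.

Lemma normr_edot a b : `|edot a b| <= enorm a * enorm b.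
Proof.
rewrite ler_norml edot_le_enorm andbT lerNl -edotNl -(enormN a).
exact: edot_le_enorm.
Qed.

Lemma enormD a b : enorm (a + b) <= enorm a + enorm b.
Proof.
rewrite -(@ler_pXn2r _ 2)// ?nnegrE ?addr_ge0 ?enorm_ge0//.
rewrite sqrrD !sqr_enorm !edotE (edotC b a).
by have := edot_le_enorm a b; lra.
Qed.

Lemma enormB a b : enorm (a - b) <= enorm a + enorm b.
Proof. by rewrite -(enormN b) enormD. Qed.

Lemma enorm_le_sum a : enorm a <= \sum_i `|a ord0 i|.
Proof.
rewrite -(@ler_pXn2r _ 2)// ?nnegrE ?enorm_ge0 ?sumr_ge0//.
rewrite sqr_enorm expr2 mulr_suml; apply: ler_sum => i _.
rewrite (le_trans (ler_norm _))// normrM ler_wpM2l// (bigD1 i)//= lerDl.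
by apply: sumr_ge0.
Qed.

Lemma ler_norm_enorm a b c :
  enorm a <= enorm b + enorm c -> `|enorm a| <= `|enorm b| + `|enorm c|.
Proof. by rewrite !ger0_norm ?enorm_ge0. Qed.

Lemma cvg_enorm (T : Type) (F : set_system T) (FF : Filter F)
    (u : T -> 'rV[R]_N) a :
  u x @[x --> F] --> a -> enorm (u x) @[x --> F] --> enorm a.
Proof.
move=> ua; rewrite /enorm /edot.
apply: continuous_cvg; first exact: sqrt_continuous.
have ci i : u x ord0 i @[x --> F] --> a ord0 i.
  exact: (cvg_comp _ _ ua (@coord_continuous _ _ _ ord0 i a)).
by apply: cvg_big => [|i _]; [exact: add_continuous|apply: cvgM; exact: ci].
Qed.

Lemma continuous_enorm : continuous (@enorm R N).
Proof. by move=> a; apply: (@cvg_enorm _ (nbhs a) _ (fun x => x)); exact: cvg_id. Qed.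

End edot_theory.

(** * Real powers *)

Section powR_theory.
Context (R : realType).
Implicit Types (p x y : R).

Lemma conjugate_gt0 p : 1 < p -> 0 < p / (p - 1).
Proof. by move=> p1; rewrite divr_gt0 ?subr_gt0// (lt_trans ltr01). Qed.

Lemma inv_conjugate p : 1 < p -> p^-1 + (p / (p - 1))^-1 = 1.
Proof.
move=> p1; have p0 : 0 < p by rewrite (lt_trans ltr01).
by rewrite invf_div -{1}(div1r p) -mulrDl addrC subrK divff// gt_eqF.
Qed.

Lemma powR_bernoulli p x : 1 < p -> 0 <= x -> 1 + p * (x - 1) <= x `^ p.
Proof.
move=> p1 x0; have p0 : 0 < p by lra.
have := conjugate_powR x0 ler01 p0 (conjugate_gt0 p1) (inv_conjugate p1).
rewrite mulr1 powR1 mul1r invf_div -mulrDl ler_pdivlMr//; lra.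
Qed.

(** Bernoulli's inequality at [y = sqrt x], squared, exceeds the claim by
    [(p ^ 2 - p) * (y - 1) ^ 2]. *)
Lemma powR_bernoulli_strict p x :
  1 < p -> 0 <= x -> x != 1 -> 1 + p * (x - 1) < x `^ p.
Proof.
move=> p1 x0 x1; set y := Num.sqrt x.
have y0 : 0 <= y by exact: sqrtr_ge0.
have xE : x = y ^+ 2 by rewrite sqr_sqrtr.
have y1 : y != 1 by apply: contra x1 => /eqP y1; rewrite xE y1 expr1n.
have yp0 := powR_ge0 y p.
have -> : x `^ p = (y `^ p) ^+ 2 by rewrite xE !expr2 powRM.
have d : 0 < (y - 1) ^+ 2 by rewrite exprn_even_gt0//= subr_eq0.
have := powR_bernoulli p1 y0; rewrite xE.
set z := y `^ p in yp0 *; move=> h.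
have [s|s] := leP 0 (1 + p * (y - 1)); last by nra.
have hz : (1 + p * (y - 1)) ^+ 2 <= z ^+ 2.
  by rewrite ler_pXn2r// nnegrE.
have gain : 0 < (p ^+ 2 - p) * (y - 1) ^+ 2.
  by rewrite mulr_gt0//; nra.
apply: lt_le_trans hz; nra.
Qed.

(** The absolute value is needed at [0], because [powR] takes the value [1] at
    negative reals. *)
Lemma powR_continuous_norm p : 0 < p -> continuous (fun x : R => `|x| `^ p).
Proof.
move=> p0 x; have [->|x0] := eqVneq x 0.
  rewrite /continuous_at normr0 powR0 ?gt_eqF//; apply/cvgrPdist_lt => e e0.
  apply/nbhs_ballP; exists (e `^ p^-1); first exact: powR_gt0.
  move=> y; rewrite /ball/= !sub0r !normrN => ye.
  rewrite (ger0_norm (powR_ge0 _ _)).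
  have -> : e = (e `^ p^-1) `^ p by rewrite -powRrM mulVf ?powRr1 ?gt_eqF ?ltW.
  by rewrite gt0_ltr_powR ?nnegrE ?powR_ge0.
rewrite /continuous_at.
have : {for `|x|, continuous (@powR R ^~ p)}.
  apply: differentiable_continuous; apply/derivable1_diffP.
  by apply: derivable_powR; rewrite in_itv/= andbT normr_gt0.
by move=> /(continuous_cvg _); apply; exact: norm_continuous.
Qed.

Lemma cvg_powR (T : Type) (F : set_system T) (FF : Filter F) (u : T -> R) x p :
  0 < p -> (forall t, 0 <= u t) -> 0 <= x ->
  u t @[t --> F] --> x -> u t `^ p @[t --> F] --> x `^ p.
Proof.
move=> p0 u0 x0 ux.
have -> : x = `|x| by rewrite ger0_norm.
under eq_fun do rewrite -[u _]ger0_norm//.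
have := @cvg_comp _ _ _ u (fun y : R => `|y| `^ p) _ _ _ ux (powR_continuous_norm p0 (x := x)).
exact.
Qed.

Lemma powR_addr_le p x y : 0 < p -> 0 <= x -> 0 <= y ->
  (x + y) `^ p <= 2 `^ p * (x `^ p + y `^ p).
Proof.
move=> p0 x0 y0; wlog xy : x y x0 y0 / x <= y.
  move=> wlg; case/orP: (le_total x y) => xy; first exact: wlg.
  by rewrite addrC [X in _ * X]addrC wlg.
rewrite (@le_trans _ _ ((2 * y) `^ p))//.
  by rewrite ge0_ler_powR ?nnegrE ?addr_ge0 ?mulr_ge0 ?(ltW p0)//; lra.
by rewrite powRM// ler_wpM2l ?powR_ge0// lerDr powR_ge0.
Qed.

End powR_theory.

(** * Uniform convexity of the power of the norm *)

Section convexity.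
Context (R : realType) (N : nat) (p : R).
Context (p1 : 1 < p).
Implicit Types (a b : 'rV[R]_N).

Let p0 : 0 < p. Proof. by rewrite (lt_trans ltr01). Qed.

Lemma edot_pflux a : edot (pflux p a) a = enorm a `^ p.
Proof.
rewrite /pflux edotZl -sqr_enorm.
have [->|a0] := eqVneq (enorm a) 0.
  by rewrite expr0n/= mulr0 powR0// gt_eqF.
rewrite -powR_mulrn ?enorm_ge0// -powRD; last by rewrite a0 implybT.
by rewrite subrK.
Qed.

Lemma enorm_pflux a : enorm (pflux p a) = enorm a `^ (p - 1).
Proof.
rewrite /pflux enormZ ger0_norm ?powR_ge0//.
have [->|a0] := eqVneq (enorm a) 0.
  by rewrite mulr0 powR0// gt_eqF// subr_gt0.
rewrite -[X in _ * X]powRr1 ?enorm_ge0// -powRD; last by rewrite a0 implybT.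
by congr (_ `^ _); lra.
Qed.

(** [p * pflux p a] is a subgradient of [|.| ^ p]: after Cauchy-Schwarz this is
    Young's inequality for the product [|a| ^ (p - 1) * |b|]. *)
Lemma pflux_subgradient a b :
  enorm a `^ p + p * edot (pflux p a) (b - a) <= enorm b `^ p.
Proof.
rewrite edotDr edotNr edot_pflux.
have := conjugate_powR (enorm_ge0 b) (powR_ge0 (enorm a) (p - 1)) p0
  (conjugate_gt0 p1) (inv_conjugate p1).
rewrite -powRrM [in X in _ <= _ + X]mulrCA mulfV ?mulr1; last first.
  by rewrite gt_eqF// subr_gt0.
rewrite invf_div mulrA -mulrDl ler_pdivlMr//.
have := edot_le_enorm (pflux p a) b; rewrite enorm_pflux.
rewrite mulrC => h1 h2.
have : p * edot (pflux p a) b <= enorm b `^ p + enorm a `^ p * (p - 1).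
  apply: le_trans h2; rewrite [leRHS]mulrC ler_pM2l//.
by lra.
Qed.

(** The deficit in the midpoint convexity of [|.| ^ p]. *)
Definition midpoint_gap a b : R :=
  (enorm a `^ p + enorm b `^ p) / 2 - enorm (2^-1 *: (a + b)) `^ p.

(** The subgradient inequalities at the midpoint, added up: their linear parts
    cancel. *)
Lemma midpoint_gap_ge0 a b : 0 <= midpoint_gap a b.
Proof.
set m := 2^-1 *: (a + b).
have := pflux_subgradient m a; have := pflux_subgradient m b.
rewrite /midpoint_gap -/m !edotDr => h1 h2.
have : edot (pflux p m) b + edot (pflux p m) a = 2 * edot (pflux p m) m.
  by rewrite -edotDr addrC -edotZr /m scalerA divff ?scale1r ?pnatr_eq0.
rewrite !edotNr in h1 h2; nra.
Qed.

(** If [|a| = |b|], the parallelogram law puts the midpoint strictly inside the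
    ball of radius [|a|]. Otherwise the triangle inequality reduces the claim
    to the strict convexity of [s ^ p] on the half-line, which is the strict
    Bernoulli inequality at [s / c]. *)
Lemma midpoint_gap_gt0 a b : a != b -> 0 < midpoint_gap a b.
Proof.
move=> ab; rewrite /midpoint_gap.
have dab : 0 < edot (a - b) (a - b).
  rewrite -sqr_enorm exprn_even_gt0//=; apply: contra ab => /eqP/enorm_eq0/eqP.
  by rewrite subr_eq0.
have [eq_ab|ne_ab] := eqVneq (enorm a) (enorm b).
  have ltm : enorm (2^-1 *: (a + b)) < enorm a.
    rewrite -(@ltr_pXn2r _ 2)// ?nnegrE ?enorm_ge0//.
    have eb : edot b b = edot a a by rewrite -!sqr_enorm eq_ab.
    move: dab; rewrite !sqr_enorm !edotE (edotC b a) eb; lra.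
  have : enorm (2^-1 *: (a + b)) `^ p < enorm a `^ p.
    by rewrite gt0_ltr_powR ?nnegrE ?enorm_ge0.
  by rewrite -eq_ab; lra.
set c := (enorm a + enorm b) / 2.
have a0 := enorm_ge0 a; have b0 := enorm_ge0 b.
have c0 : 0 < c.
  rewrite divr_gt0// lt0r addr_ge0// andbT paddr_eq0//.
  by apply: contra ne_ab => /andP[/eqP-> /eqP->].
have mc : enorm (2^-1 *: (a + b)) `^ p <= c `^ p.
  rewrite ge0_ler_powR ?nnegrE ?enorm_ge0 ?(ltW p0) ?(ltW c0)//.
  rewrite enormZ ger0_norm ?invr_ge0// mulrC ler_wpM2r ?invr_ge0//.
  exact: enormD.
have strict x : 0 <= x -> x != c -> c `^ p + p * c `^ p * (x / c - 1) < x `^ p.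
  move=> x0 xc; have xc0 : 0 <= x / c by rewrite divr_ge0// ltW.
  have xc1 : x / c != 1.
    by apply: contra xc => /eqP xc1; rewrite -(divfK (lt0r_neq0 c0) x) xc1 mul1r.
  have := powR_bernoulli_strict p1 xc0 xc1.
  have -> : x `^ p = c `^ p * (x / c) `^ p.
    by rewrite -powRM ?(ltW c0)// mulrC divfK// gt_eqF.
  rewrite -(ltr_pM2l (powR_gt0 p c0)); lra.
have ac : enorm a != c by apply: contra ne_ab => /eqP; rewrite /c => h; apply/eqP; lra.
have bc : enorm b != c by apply: contra ne_ab => /eqP; rewrite /c => h; apply/eqP; lra.
have := strict _ a0 ac; have := strict _ b0 bc.
have : enorm a / c - 1 + (enorm b / c - 1) = 0.
  by rewrite addrACA -mulrDl /c; field; rewrite gt_eqF//; move: c0; rewrite /c; lra.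
set s := enorm a / c - 1; set t := enorm b / c - 1 => st.
have -> : s = - t by lra.
nra.
Qed.

Lemma midpoint_gapZ k a b : 0 <= k ->
  midpoint_gap (k *: a) (k *: b) = k `^ p * midpoint_gap a b.
Proof.
move=> k0; rewrite /midpoint_gap.
have -> : 2^-1 *: (k *: a + k *: b) = k *: (2^-1 *: (a + b)).
  by rewrite -scalerDr !scalerA mulrC.
rewrite ![enorm (k *: _)]enormZ (ger0_norm k0) !powRM ?enorm_ge0//.
by rewrite -mulrDr -mulrA -mulrBr.
Qed.

(** The pairs in question form a compact set, on which the gap is continuous
    and positive. *)
Lemma midpoint_gap_bounded_below (e : R) : 0 < e ->
  exists2 c : R, 0 < c & forall a b,
    enorm a + enorm b = 1 -> e <= enorm (a - b) -> c <= midpoint_gap a b.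
Proof.
move=> e0.
pose B := [set a : 'rV[R]_N | enorm a <= 1].
pose S := [set x : 'rV[R]_N * 'rV[R]_N |
  enorm x.1 + enorm x.2 = 1 /\ e <= enorm (x.1 - x.2)].
have cB : compact B.
  apply: bounded_closed_compact.
    exists 1; split; first exact: num_real.
    move=> M M1 a /= a1; rewrite [leLHS]mx_normrE.
    apply/bigmax_leP; split; first lra.
    move=> [i j] _ /=; rewrite ord1 (le_trans (ler_coord_enorm a j))//.
    by move: a1; rewrite /B/=; lra.
  rewrite /B (_ : mkset _ = @enorm R N @^-1` [set x | x <= 1])//.
  by apply: closed_comp; [move=> ? _; exact: continuous_enorm|exact: closed_le].
have cf1 : continuous (fun x : 'rV[R]_N * 'rV[R]_N => enorm x.1).
  by move=> x; apply: cvg_enorm; exact: cvg_fst.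
have cf2 : continuous (fun x : 'rV[R]_N * 'rV[R]_N => enorm x.2).
  by move=> x; apply: cvg_enorm; exact: cvg_snd.
have cf12 : continuous (fun x : 'rV[R]_N * 'rV[R]_N => enorm (x.1 - x.2)).
  by move=> x; apply: cvg_enorm; apply: cvgB; [exact: cvg_fst|exact: cvg_snd].
have cS : compact S.
  apply: (subclosed_compact _ (compact_setX cB cB)).
    have -> : S = ((fun x => enorm x.1 + enorm x.2) @^-1` [set x | x = 1]) `&`
                  ((fun x => enorm (x.1 - x.2)) @^-1` [set x | e <= x]) by [].
    apply: closedI; apply: closed_comp.
    - by move=> x _; apply: cvgD; [exact: cf1|exact: cf2].
    - exact: closed_eq.
    - by move=> x _; exact: cf12.
    - exact: closed_ge.
  move=> [a b] [/= ab1 _]; split; rewrite /B/=.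
    by have := enorm_ge0 b; lra.
  by have := enorm_ge0 a; lra.
have cg : continuous (fun x : 'rV[R]_N * 'rV[R]_N => midpoint_gap x.1 x.2).
  move=> x; rewrite /midpoint_gap; apply: cvgB; last first.
    apply: cvg_powR => //; [by move=> ?; exact: enorm_ge0|exact: enorm_ge0|].
    apply: cvg_enorm; apply: cvgZ; first exact: cvg_cst.
    by apply: cvgD; [exact: cvg_fst|exact: cvg_snd].
  apply: cvgM; last exact: cvg_cst.
  apply: cvgD; apply: cvg_powR; rewrite ?enorm_ge0//;
    by [move=> ?; exact: enorm_ge0|exact: cf1|exact: cf2].
have [[x Sx]|noS] := pselect (S !=set0); last first.
  by exists 1 => // a b ab1 eab; exfalso; apply: noS; exists (a, b).
have [x0 Sx0 x0min] := compact_EVT_min (ex_intro _ x Sx) cS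
  (continuous_subspaceT cg).
exists (midpoint_gap x0.1 x0.2) => [|a b ab1 eab].
  move/set_mem: Sx0 => [_ ex0]; apply: midpoint_gap_gt0; apply/negP => /eqP h.
  by move: ex0; rewrite h subrr enorm0 leNgt e0.
by apply: (x0min (a, b)); rewrite inE.
Qed.

(** By homogeneity one may assume [|a| + |b| = 1]; then either [a - b] is small
    or the gap is bounded below. The compactness argument treats all [p > 1]
    alike, whereas Clarkson's inequalities differ for [p < 2] and [p >= 2]. *)
Lemma uniform_convexity (e : R) : 0 < e -> exists2 C : R, 0 < C & forall a b,
  enorm (a - b) `^ p <= e * (enorm a `^ p + enorm b `^ p) + C * midpoint_gap a b.
Proof.
move=> e0; (* [h] solves [h ^ p * 2 ^ p = e] *)
pose h := (e / 2 `^ p) `^ p^-1.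
have two0 : 0 < 2 `^ p :> R by exact: powR_gt0.
have h0 : 0 < h by rewrite powR_gt0// divr_gt0.
have hp : h `^ p = e / 2 `^ p.
  by rewrite -powRrM mulVf ?gt_eqF// powRr1// divr_ge0 ?ltW.
have [c c0 cgap] := midpoint_gap_bounded_below h0.
exists c^-1; first by rewrite invr_gt0.
move=> a b; set s := enorm a + enorm b.
have a0 := enorm_ge0 a; have b0 := enorm_ge0 b.
have s0 : 0 <= s by rewrite addr_ge0.
have gap0 := midpoint_gap_ge0 a b.
have [hs|sh] := leP (enorm (a - b)) (h * s).
  rewrite (@le_trans _ _ (e * (enorm a `^ p + enorm b `^ p)))//; last first.
    by rewrite lerDl mulr_ge0// invr_ge0 ltW.
  rewrite (@le_trans _ _ ((h * s) `^ p))//.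
    by rewrite ge0_ler_powR ?nnegrE ?enorm_ge0 ?mulr_ge0 ?(ltW p0) ?(ltW h0).
  rewrite powRM ?(ltW h0)// hp -mulrA ler_pM2l// ler_pdivrMl//.
  exact: powR_addr_le.
have {}s0 : 0 < s.
  rewrite lt0r s0 andbT; apply/negP => /eqP sE.
  move: sh; rewrite sE mulr0 ltNge (le_trans (enormB _ _))//.
  by rewrite -/s sE.
have sV : 0 <= s^-1 by rewrite invr_ge0 ltW.
rewrite (@le_trans _ _ (c^-1 * midpoint_gap a b))//; last first.
  by rewrite lerDr mulr_ge0 ?(ltW e0)// addr_ge0 ?powR_ge0.
have := cgap (s^-1 *: a) (s^-1 *: b).
rewrite -scalerBr !enormZ (ger0_norm sV) -mulrDr mulVf ?gt_eqF//.
rewrite ler_pdivlMl// mulrC => /(_ erefl (ltW sh)).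
rewrite midpoint_gapZ// ler_pdivlMl// => h1.
have -> : midpoint_gap a b = s `^ p * (s^-1 `^ p * midpoint_gap a b).
  by rewrite mulrA -powRM ?(ltW s0)// divff ?gt_eqF// powR1 mul1r.
rewrite mulrC (le_trans _ (ler_wpM2l (powR_ge0 s p) h1))// ler_wpM2r ?(ltW c0)//.
by rewrite ge0_ler_powR ?nnegrE ?enorm_ge0 ?(ltW p0) ?(ltW s0)// enormB.
Qed.

(** At [a = 0] the factor [|.| ^ (p - 2)] is unbounded when [p < 2]; there the
    norm [|.| ^ (p - 1)] of the flux is used instead. *)
Lemma cvg_pflux (T : Type) (F : set_system T) (FF : Filter F)
    (u : T -> 'rV[R]_N) a b :
  u x @[x --> F] --> a ->
  edot (pflux p (u x)) b @[x --> F] --> edot (pflux p a) b.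
Proof.
move=> ua; have [aE|a0] := eqVneq a 0.
  rewrite aE in ua *.
  have -> : edot (pflux p 0) b = 0 by rewrite /pflux scaler0 -(scale0r 0) edotZl mul0r.
  apply/cvgr0Pnorm_le => e e0.
  have : enorm (u x) `^ (p - 1) * enorm b @[x --> F] --> 0.
    rewrite -[X in _ --> X](mul0r (enorm b)); apply: cvgM; last exact: cvg_cst.
    rewrite -[X in _ --> X](@powR0 _ (p - 1)) ?gt_eqF ?subr_gt0//.
    rewrite -(enorm0 R N).
    apply: cvg_powR; rewrite ?subr_gt0 ?enorm_ge0//.
    - by move=> x; exact: enorm_ge0.
    - by apply: cvg_enorm.
  move=> /(@cvgr0Pnorm_le _ _ _ F _) h; move: (h e e0); apply: filterS => x.
  rewrite -enorm_pflux; apply: le_trans; rewrite (le_trans (normr_edot _ _))//.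
  exact: ler_norm.
rewrite /pflux.
under eq_fun do rewrite edotZl.
rewrite edotZl; apply: cvgM.
  have : {for enorm a, continuous (@powR R ^~ (p - 2))}.
    apply: differentiable_continuous; apply/derivable1_diffP.
    apply: derivable_powR; rewrite in_itv/= andbT lt0r enorm_ge0 andbT.
    by apply: contra a0 => /eqP/enorm_eq0 ->.
  move=> /(continuous_cvg _); apply; exact: cvg_enorm.
apply: cvg_big => [|i _]; first exact: add_continuous.
apply: cvgM; last exact: cvg_cst.
exact: (cvg_comp _ _ ua (@coord_continuous _ _ _ ord0 i a)).
Qed.
End convexity.

(** * Functions with integrable power *)

Section energy.
Context d (T : measurableType d) (R : realType).
Context (mu : {measure set T -> \bar R}) (D : set T) (mD : measurable D).
Implicit Types (f g h : T -> R) (p : R).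

(** Membership in [L^p(D)] is expressed by the integral of the [p]-th power:
    [p]-th powers can be compared pointwise under the integral, and no roots
    occur. *)
Definition LpOn p f :=
  measurable_fun D f /\ mu.-integrable D (fun x => (`|f x| `^ p)%:E).

Definition energy p f : R := \int[mu]_(x in D) (`|f x| `^ p).

Lemma EFin_Rintegral h : mu.-integrable D (EFin \o h) ->
  (\int[mu]_(x in D) h x)%:E = (\int[mu]_(x in D) (h x)%:E)%E.
Proof. by move=> ih; rewrite /Rintegral fineK//; exact: integrable_fin_num. Qed.

Lemma integrable_EFin_le g h : measurable_fun D h ->
  (forall x, D x -> `|h x| <= g x) -> mu.-integrable D (EFin \o g) ->
  mu.-integrable D (EFin \o h).
Proof.
move=> mh hg; apply: le_integrable => //; first exact/measurable_EFinP.
move=> x Dx /=; rewrite lee_fin (le_trans (hg x Dx))//; exact: ler_norm.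
Qed.

Lemma integrable_EFinZ k h : mu.-integrable D (EFin \o h) ->
  mu.-integrable D (EFin \o (fun x => k * h x)).
Proof.
move=> ih; have := integrableZl mD k ih; apply: eq_integrable => //.
Qed.

Lemma integrable_EFinD g h : mu.-integrable D (EFin \o g) ->
  mu.-integrable D (EFin \o h) -> mu.-integrable D (EFin \o (fun x => g x + h x)).
Proof.
by move=> ig ih; have := integrableD mD ig ih; apply: eq_integrable.
Qed.

(** A pointwise estimate by three functions, integrated; it carries convexity
    inequalities over to integrals. *)
Lemma le_Rintegral_lin3 (a b c : R) (g1 g2 g3 h : T -> R) :
  mu.-integrable D (EFin \o g1) -> mu.-integrable D (EFin \o g2) ->
  mu.-integrable D (EFin \o g3) -> mu.-integrable D (EFin \o h) ->
  (forall x, D x -> h x <= a * g1 x + b * g2 x + c * g3 x) ->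
  \int[mu]_(x in D) h x <= a * \int[mu]_(x in D) g1 x +
    b * \int[mu]_(x in D) g2 x + c * \int[mu]_(x in D) g3 x.
Proof.
move=> I1 I2 I3 Ih hg.
have Ia := integrable_EFinZ a I1; have Ib := integrable_EFinZ b I2.
have Ic := integrable_EFinZ c I3; have Iab := integrable_EFinD Ia Ib.
rewrite -!RintegralZl// -!RintegralD//; apply: le_Rintegral => //.
exact: integrable_EFinD.
Qed.

Lemma measurable_powR_normr p f : measurable_fun D f ->
  measurable_fun D (fun x => `|f x| `^ p).
Proof.
move=> mf; apply: (@measurableT_comp _ _ _ _ _ _ (@powR R ^~ p)) => //.
exact: measurableT_comp.
Qed.

Lemma energy_ge0 p f : 0 <= energy p f.
Proof. by apply: Rintegral_ge0 => x _; exact: powR_ge0. Qed.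

Lemma LpOn_le p f g : 0 <= p -> measurable_fun D f ->
  (forall x, D x -> `|f x| <= `|g x|) -> LpOn p g -> LpOn p f.
Proof.
move=> p0 mf fg [mg ig]; split => //; apply: integrable_EFin_le ig.
  exact: measurable_powR_normr.
move=> x Dx; rewrite ger0_norm ?powR_ge0// ge0_ler_powR ?nnegrE//.
exact: fg.
Qed.

Lemma energy_le p f g : 0 <= p -> LpOn p f -> LpOn p g ->
  (forall x, D x -> `|f x| <= `|g x|) -> energy p f <= energy p g.
Proof.
move=> p0 [mf If] [mg Ig] fg; apply: le_Rintegral => // x Dx.
by rewrite ge0_ler_powR ?nnegrE//; exact: fg.
Qed.

Lemma LpOnZ p k f : LpOn p f -> LpOn p (fun x => k * f x).
Proof.
move=> [mf If]; split; first exact: measurable_funM.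
have := integrable_EFinZ (`|k| `^ p) If; apply: eq_integrable => // x _ /=.
by rewrite normrM powRM.
Qed.

Lemma energyZ p k f : LpOn p f ->
  energy p (fun x => k * f x) = `|k| `^ p * energy p f.
Proof.
move=> [mf If]; rewrite /energy -RintegralZl//.
by apply: eq_Rintegral => x _; rewrite normrM powRM.
Qed.

Lemma LpOnN p f : LpOn p f -> LpOn p (fun x => - f x).
Proof.
by move/(LpOnZ (-1)); rewrite (_ : (fun x => -1 * f x) = fun x => - f x)//;
  apply/funext => x; rewrite mulN1r.
Qed.

Lemma energy_norm p f : energy p (fun x => `|f x|) = energy p f.
Proof. by apply: eq_Rintegral => x _; rewrite normr_id. Qed.

Lemma energy_distC p f g :
  energy p (fun x => f x - g x) = energy p (fun x => g x - f x).
Proof. by apply: eq_Rintegral => x _; rewrite distrC. Qed.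

Lemma LpOn_norm p f : LpOn p f -> LpOn p (fun x => `|f x|).
Proof.
move=> [mf If]; split; first exact: measurableT_comp.
by apply: eq_integrable If => // x _ /=; rewrite normr_id.
Qed.

Let dominatorD p f g : LpOn p f -> LpOn p g ->
  mu.-integrable D (EFin \o (fun x => 2 `^ p * (`|f x| `^ p + `|g x| `^ p))).
Proof.
by move=> [_ If] [_ Ig]; apply: integrable_EFinZ; exact: integrable_EFinD.
Qed.

Let le_dominatorD p f g x : 0 < p ->
  `|f x + g x| `^ p <= 2 `^ p * (`|f x| `^ p + `|g x| `^ p).
Proof.
move=> p0; apply: le_trans (powR_addr_le p0 (normr_ge0 _) (normr_ge0 _)).
by rewrite ge0_ler_powR ?nnegrE ?addr_ge0 ?(ltW p0)// ler_normD.
Qed.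

Lemma LpOnD p f g : 0 < p -> LpOn p f -> LpOn p g ->
  LpOn p (fun x => f x + g x).
Proof.
move=> p0 Lf Lg; have mfg : measurable_fun D (fun x => f x + g x).
  by apply: measurable_funD; [case: Lf|case: Lg].
split => //; apply: integrable_EFin_le (dominatorD Lf Lg).
  exact: measurable_powR_normr.
by move=> x _; rewrite ger0_norm ?powR_ge0//; exact: le_dominatorD.
Qed.

Lemma LpOnB p f g : 0 < p -> LpOn p f -> LpOn p g ->
  LpOn p (fun x => f x - g x).
Proof. by move=> p0 Lf Lg; apply: LpOnD => //; exact: LpOnN. Qed.

Lemma LpOn_sum (I : Type) (r : seq I) p (F : I -> T -> R) : 0 < p ->
  (forall i, LpOn p (F i)) -> LpOn p (fun x => \sum_(i <- r) F i x).
Proof.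
move=> p0 LF; elim: r => [|i r IH].
  under eq_fun do rewrite big_nil.
  split => //; apply: (@eq_integrable _ _ _ _ _ mD (cst 0%E)) => [x _ /=|].
    by rewrite normr0 powR0// gt_eqF.
  exact: integrable0.
by under eq_fun do rewrite big_cons; exact: LpOnD.
Qed.

Lemma energyD_le p f g : 0 < p -> LpOn p f -> LpOn p g ->
  energy p (fun x => f x + g x) <= 2 `^ p * (energy p f + energy p g).
Proof.
move=> p0 Lf Lg; have [_ Ifg] := LpOnD p0 Lf Lg.
have [_ If] := Lf; have [_ Ig] := Lg.
rewrite -RintegralD// -RintegralZl//; last exact: integrable_EFinD.
apply: le_Rintegral => //; first exact: dominatorD.
by move=> x _; exact: le_dominatorD.
Qed.

Lemma energy_eq0 p f : 0 < p -> LpOn p f -> energy p f = 0 ->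
  {ae mu, forall x, D x -> f x = 0}.
Proof.
move=> p0 [mf If] f0.
have : (\int[mu]_(x in D) `|(`|f x| `^ p)%:E| = 0)%E.
  under eq_integral do rewrite gee0_abs ?lee_fin ?powR_ge0//.
  by rewrite -EFin_Rintegral// -/(energy p f) f0.
move=> /ae_eq_integral_abs; have /integrableP[mfp _] := If.
move=> /(_ mD mfp); apply: filterS => x /= /[apply] -[].
by move=> /powR_eq0_eq0/normr0_eq0.
Qed.

Section pairing.
Context (p q : R) (p0 : 0 < p) (q0 : 0 < q) (pq : p^-1 + q^-1 = 1).

Let p_ge1 : 1 <= p.
Proof. by rewrite -invf_le1// -pq lerDl invr_ge0 ltW. Qed.

Let q_ge1 : 1 <= q.
Proof. by rewrite -invf_le1// -pq lerDr invr_ge0 ltW. Qed.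

(** The free parameter [l] shifts the weight between the two terms. *)
Lemma young_scaled l (a b : R) : 0 < l -> 0 <= a -> 0 <= b ->
  a * b <= l `^ p * a `^ p + l^-1 `^ q * b `^ q.
Proof.
move=> l0 a0 b0; have lV0 : 0 <= l^-1 by rewrite invr_ge0 ltW.
have -> : a * b = (l * a) * (l^-1 * b) by field; rewrite gt_eqF.
rewrite (le_trans (conjugate_powR _ _ p0 q0 pq)) ?mulr_ge0 ?(ltW l0)//.
rewrite !powRM ?(ltW l0)// lerD//.
  by rewrite ler_piMr ?mulr_ge0 ?powR_ge0// invf_le1.
by rewrite ler_piMr ?mulr_ge0 ?powR_ge0// invf_le1.
Qed.

Let dominator l f g : LpOn p f -> LpOn q g -> mu.-integrable D
  (EFin \o (fun x => l `^ p * `|f x| `^ p + l^-1 `^ q * `|g x| `^ q)).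
Proof.
by move=> [_ If] [_ Ig]; apply: integrable_EFinD; exact: integrable_EFinZ.
Qed.

Let le_dominator l f g h : 0 < l -> (forall x, D x -> `|h x| <= `|f x| * `|g x|) ->
  forall x, D x -> `|h x| <= l `^ p * `|f x| `^ p + l^-1 `^ q * `|g x| `^ q.
Proof.
by move=> l0 hfg x Dx; rewrite (le_trans (hfg x Dx))// young_scaled.
Qed.

Lemma integrable_pairing f g h : LpOn p f -> LpOn q g -> measurable_fun D h ->
  (forall x, D x -> `|h x| <= `|f x| * `|g x|) -> mu.-integrable D (EFin \o h).
Proof.
move=> Lf Lg mh hfg; apply: (integrable_EFin_le mh) (dominator 1 Lf Lg).
by apply: le_dominator.
Qed.

Lemma pairing_le l f g h : 0 < l -> LpOn p f -> LpOn q g ->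
  measurable_fun D h -> (forall x, D x -> `|h x| <= `|f x| * `|g x|) ->
  `|\int[mu]_(x in D) h x| <= l `^ p * energy p f + l^-1 `^ q * energy q g.
Proof.
move=> l0 Lf Lg mh hfg; have Ih := integrable_pairing Lf Lg mh hfg.
have [[_ If] [_ Ig]] := (Lf, Lg).
apply: le_trans (le_normr_Rintegral mD Ih) _.
rewrite -!RintegralZl// -RintegralD//; [|exact: integrable_EFinZ..].
apply: le_Rintegral => //; [exact: integrable_norm|exact: dominator|].
exact: le_dominator.
Qed.

(** Integration against a fixed [g] in the dual space is continuous at [0]. The
    integrand is only required to be dominated by the product, so that dot
    products of vector fields are covered as well. *)
Lemma pairing_small g e : LpOn q g -> 0 < e -> exists2 r, 0 < r &
  forall f h, LpOn p f -> energy p f <= r -> measurable_fun D h ->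
  (forall x, D x -> `|h x| <= `|f x| * `|g x|) ->
  `|\int[mu]_(x in D) h x| <= e.
Proof.
move=> Lg e0; have Eg := energy_ge0 q g.
(* l is chosen so that the second term of the scaled Young inequality is at
   most e / 2 *)
pose l := ((2 * energy q g + 1) / e) `^ q^-1.
have c0 : 0 < (2 * energy q g + 1) / e by rewrite divr_gt0//; lra.
have l0 : 0 < l by exact: powR_gt0.
have lq : l^-1 `^ q = e / (2 * energy q g + 1).
  rewrite -powR_inv1 ?(ltW l0)// powRAC.
  have -> : l `^ q = (2 * energy q g + 1) / e.
    by rewrite /l -powRrM mulVf ?gt_eqF// powRr1 ?(ltW c0).
  by rewrite powR_inv1 ?(ltW c0)// invf_div.
have lp0 : 0 < l `^ p by exact: powR_gt0.
exists (e / 2 / l `^ p); first by rewrite !divr_gt0.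
move=> f h Lf fr mh hfg; apply: le_trans (pairing_le l0 Lf Lg mh hfg) _.
rewrite (splitr e) lerD//.
  by rewrite mulrC -ler_pdivlMr.
by rewrite lq mulrAC ler_pdivrMr ?ltr_pwDr//; nra.
Qed.

End pairing.

(** Correcting [s k] by the bound [2 * M / 2 ^ k] on its remaining variation
    makes it monotone and bounded. *)
Lemma cvg_geometric_steps (s : nat -> R) (M : R) :
  (forall k, `|s k - s k.+1| <= M * 2^-1 ^+ k) -> cvgn s.
Proof.
move=> sM; have M0 : 0 <= M by have := sM 0%N; rewrite expr0 mulr1; apply: le_trans.
pose a k := s k + 2 * M * 2^-1 ^+ k.
pose b k := s k - 2 * M * 2^-1 ^+ k.
have a_dec : nonincreasing_seq a.
  apply/nonincreasing_seqP => k; rewrite /a exprS.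
  by have := sM k; rewrite ler_norml => /andP[]; lra.
have b_inc : nondecreasing_seq b.
  apply/nondecreasing_seqP => k; rewrite /b exprS.
  by have := sM k; rewrite ler_norml => /andP[]; lra.
have ca : cvgn a.
  apply: nonincreasing_is_cvgn => //; exists (b 0%N) => _ [k _ <-].
  rewrite (le_trans (b_inc _ _ (leq0n k)))// /a /b.
  have : 0 <= 2 * M * 2^-1 ^+ k by rewrite !mulr_ge0// exprn_ge0.
  lra.
have ch : cvgn (fun k => 2 * M * 2^-1 ^+ k : R).
  apply: is_cvgM; first exact: is_cvg_cst.
  by apply/cvg_ex; exists 0; apply: cvg_expr; rewrite ger0_norm// invf_lt1// ltr1n.
rewrite (_ : s = fun k => a k - 2 * M * 2^-1 ^+ k); first exact: is_cvgB.
by apply/funext => k; rewrite /a addrK.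
Qed.

(** If consecutive functions of a sequence are this close, then [\sum_k (2 ^ k
    * |f_k - f_(k+1)|) ^ p] has a finite integral. *)
Definition rate p k : R := 2^-1 ^+ k * (2^-1 ^+ k) `^ p.

Lemma rate_gt0 p k : 0 < rate p k.
Proof. by rewrite mulr_gt0 ?powR_gt0 ?exprn_gt0. Qed.

Lemma rate_small p (e : R) : 0 < p -> 0 < e ->
  exists K, forall k, (K <= k)%N -> rate p k <= e.
Proof.
move=> p0 e0.
have : (2^-1 : R) ^+ k @[k --> \oo] --> 0.
  by apply: cvg_expr; rewrite ger0_norm// invf_lt1// ltr1n.
move=> /cvgrPdist_lt/(_ _ e0)[K _ Ke]; exists K => k /Ke /=.
rewrite sub0r normrN ger0_norm ?exprn_ge0// => /ltW; apply: le_trans.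
rewrite /rate ler_piMr ?exprn_ge0//; apply: (@le_trans _ _ (1 `^ p)); last by rewrite powR1.
rewrite ge0_ler_powR ?nnegrE ?exprn_ge0 ?(ltW p0)//.
by rewrite exprn_ile1// invf_le1// ler1n.
Qed.

(** The sum [\sum_k (2 ^ k * |f_k - f_(k+1)|) ^ p] has a finite integral, hence
    is finite almost everywhere, and where it is finite the steps of the
    sequence are bounded by a multiple of [2 ^ - k]. *)
Lemma LpOn_fast_cauchy_ae p (f : nat -> T -> R) : 0 < p ->
  (forall k, LpOn p (f k)) ->
  (forall k, energy p (fun x => f k x - f k.+1 x) <= rate p k) ->
  {ae mu, forall x, D x -> cvgn (f ^~ x)}.
Proof.
move=> p0 Lf ff.
pose H k x : R := (2^-1 ^+ k) `^ (- p) * `|f k x - f k.+1 x| `^ p.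
have H0 k x : 0 <= H k x by rewrite mulr_ge0 ?powR_ge0.
have Ldiff k := LpOnB p0 (Lf k) (Lf k.+1).
have mH k : measurable_fun D (EFin \o H k).
  apply/measurable_EFinP; apply: measurable_funM => //.
  by apply: measurable_powR_normr; case: (Ldiff k).
have iH k : (\int[mu]_(x in D) (H k x)%:E <= (2^-1 ^+ k)%:E)%E.
  have -> : (\int[mu]_(x in D) (H k x)%:E =
      ((2^-1 ^+ k) `^ (- p) * energy p (fun x => f k x - f k.+1 x))%:E)%E.
    have [_ Id] := Ldiff k.
    by rewrite -RintegralZl// EFin_Rintegral//; exact: integrable_EFinZ.
  by rewrite lee_fin powRN mulrC ler_pdivrMr ?powR_gt0 ?exprn_gt0//.
pose S x : \bar R := (\sum_(0 <= k <oo) (H k x)%:E)%E.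
have S_ge0 x : (0 <= S x)%E by apply: nneseries_ge0 => k _ _; rewrite lee_fin.
have mS : measurable_fun D S.
  rewrite /S.
  apply: (@ge0_emeasurable_sum _ _ _ D (fun k x => (H k x)%:E) xpredT) => [k x _ _|k _].
    by rewrite lee_fin.
  exact: mH.
have iS : mu.-integrable D S.
  apply/integrableP; split => //.
  under eq_integral do rewrite gee0_abs//.
  rewrite integral_nneseries//; last by move=> k x _; rewrite lee_fin.
  apply: (@le_lt_trans _ _ (\sum_(0 <= k <oo) (2^-1 ^+ k)%:E)%E).
    by apply: lee_nneseries => [k *|k *]; [apply: integral_ge0 => x _; rewrite lee_fin|exact: iH].
  have geom n : \sum_(0 <= k < n) 2^-1 ^+ k = 2 - 2 * 2^-1 ^+ n :> R.
    elim: n => [|n IH]; first by rewrite big_nil expr0 mulr1 subrr.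
    by rewrite big_nat_recr//= IH exprS; field.
  apply: (@le_lt_trans _ _ 2%:E); last exact: ltry.
  apply: lime_le.
    by apply: is_cvg_nneseries => k _ _; rewrite lee_fin exprn_ge0.
  apply: nearW => n; rewrite sumEFin lee_fin geom lerBlDr lerDl.
  by rewrite mulr_ge0// exprn_ge0.
apply: filterS (integrable_ae mD iS) => x /[swap] Dx /(_ Dx) Sx.
apply: (@cvg_geometric_steps _ (fine (S x) `^ p^-1)) => k.
have HS : H k x <= fine (S x).
  rewrite -lee_fin fineK//.
  apply: le_trans (@nneseries_lim_ge _ _ xpredT 0 k.+1 _); last first.
    by move=> n _ _; rewrite lee_fin.
  rewrite big_nat_recr//= leeDr// sume_ge0// => n _.
  by rewrite lee_fin.
have r0 : 0 < 2^-1 ^+ k :> R by rewrite exprn_gt0.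
have -> : `|f k x - f k.+1 x| = (H k x) `^ p^-1 * 2^-1 ^+ k.
  have rE : 2^-1 ^+ k = ((2^-1 ^+ k) `^ p) `^ p^-1 :> R.
    by rewrite -powRrM mulfV ?gt_eqF// powRr1 ?ltW.
  rewrite [X in _ = _ * X]rE -powRM ?powR_ge0// /H mulrAC powRN mulVf ?mul1r.
    by rewrite -powRrM mulfV ?gt_eqF// powRr1.
  by rewrite gt_eqF// powR_gt0.
rewrite ler_wpM2r ?(ltW r0)// ge0_ler_powR ?nnegrE ?invr_ge0 ?(ltW p0)//.
by rewrite fine_ge0.
Qed.

Lemma limn_einf_le (u : nat -> \bar R) (e : \bar R) :
  (forall n, (u n <= e)%E) -> (limn_einf u <= e)%E.
Proof.
move=> ue; rewrite limn_einf_lim; apply: lime_le; first exact: is_cvg_einfs.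
apply: nearW => n; rewrite (le_trans _ (ue n))//.
by apply: ereal_inf_lbound; exists n => /=.
Qed.

(** Completeness of [L^p(D)], for Cauchy sequences with a prescribed rate. The
    distance to the almost everywhere limit is estimated by Fatou's lemma. *)
Lemma LpOn_complete p (f : nat -> T -> R) : 0 < p ->
  (forall k, LpOn p (f k)) ->
  (forall k l, (k <= l)%N -> energy p (fun x => f k x - f l x) <= rate p k) ->
  exists g, [/\ LpOn p g,
    forall k, energy p (fun x => g x - f k x) <= rate p k &
    {ae mu, forall x, D x -> f k x @[k --> \oo] --> g x}].
Proof.
move=> p0 Lf ff.
have [N [mN N0 subN]] := LpOn_fast_cauchy_ae p0 Lf (fun k => ff k k.+1 (leqnSn k)).
have cvgf x : D x -> ~ N x -> cvgn (f ^~ x).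
  by move=> Dx Nx; apply: contrapT => h; apply/Nx/subN => /= /(_ Dx).
pose g x : R := limn (fun k => f k x * \1_(~` N) x).
have fN_cvg x : D x -> f k x * \1_(~` N) x @[k --> \oo] --> g x.
  move=> Dx; suff : cvgn (fun k => f k x * \1_(~` N) x) by [].
  have [Nx|Nx] := pselect (N x).
    have -> : (fun k => f k x * \1_(~` N) x) = fun=> 0.
      by apply/funext => k; rewrite indicE memNset ?mulr0//=; apply.
    exact: is_cvg_cst.
  have -> : (fun k => f k x * \1_(~` N) x) = f ^~ x.
    by apply/funext => k; rewrite indicE mem_set// mulr1.
  exact: cvgf.
have mI : measurable_fun D (\1_(~` N) : T -> R).
  by apply: measurable_indic; exact: measurableC.
have mg : measurable_fun D g.
  apply: measurable_fun_cvg fN_cvg => k; apply: measurable_funM => //.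
  by case: (Lf k).
have f_cvg : {ae mu, forall x, D x -> f k x @[k --> \oo] --> g x}.
  exists N; split => // x /= h; apply: contrapT => Nx; apply: h => Dx.
  have := fN_cvg x Dx; rewrite indicE mem_set//.
  by under eq_fun do rewrite mulr1.
have gf k : (\int[mu]_(x in D) (`|g x - f k x| `^ p)%:E <= (rate p k)%:E)%E.
  pose F l x : R := `|f (k + l)%N x * \1_(~` N) x - f k x| `^ p.
  have mF l : measurable_fun D (EFin \o F l).
    apply/measurable_EFinP; apply: measurable_powR_normr.
    by apply: measurable_funB; [apply: measurable_funM => //|];
      [case: (Lf (k + l)%N)|case: (Lf k)].
  have F_cvg x : D x -> limn_einf (fun l => (F l x)%:E) = (`|g x - f k x| `^ p)%:E.
    move=> Dx; have : (F l x)%:E @[l --> \oo] --> (`|g x - f k x| `^ p)%:E.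
      apply: cvg_EFin; first by apply: nearW.
      apply: cvg_powR => //; apply: cvg_norm; apply: cvgB; last exact: cvg_cst.
      by have := fN_cvg x Dx; rewrite -(cvg_shiftn k); under eq_fun do rewrite addnC.
    by move=> /cvg_limn_einf_sup[].
  have := fatou mu mD mF (fun l x _ => powR_ge0 _ _).
  rewrite (eq_integral (fun x => (`|g x - f k x| `^ p)%:E)); last first.
    by move=> x /set_mem Dx; exact: F_cvg.
  move=> /le_trans; apply; apply: limn_einf_le => l.
  have Lkl := LpOnB p0 (Lf (k + l)%N) (Lf k).
  rewrite (ae_eq_integral (fun x => (`|f (k + l)%N x - f k x| `^ p)%:E))//.
  - have [_ Ikl] := Lkl; rewrite -EFin_Rintegral// lee_fin.
    by rewrite -/(energy p _) energy_distC ff ?leq_addr.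
  - by apply/measurable_EFinP/measurable_powR_normr; case: Lkl.
  - exists N; split => // x /= h; apply: contrapT => Nx; apply: h => Dx.
    by rewrite /F indicE mem_set// mulr1.
have Lgf k : LpOn p (fun x => g x - f k x).
  have mgf : measurable_fun D (fun x => g x - f k x).
    by apply: measurable_funB => //; case: (Lf k).
  split => //; apply/integrableP; split.
    by apply/measurable_EFinP; exact: measurable_powR_normr.
  under eq_integral do rewrite gee0_abs ?lee_fin ?powR_ge0//.
  exact: le_lt_trans (gf k) (ltry _).
exists g; split => //.
- have := LpOnD p0 (Lgf 0%N) (Lf 0%N).
  by under eq_fun do rewrite subrK.
- by move=> k; have [_ Igf] := Lgf k; rewrite -lee_fin EFin_Rintegral.
Qed.

End energy.

(** * Borel sets of the Euclidean space *)

Section borel_rV.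
Context (R : realType) (N : nat).
Implicit Types (U : set 'rV[R]_N) (g : 'rV[R]_N -> R).

Lemma measurable_rV_box (A : 'I_N -> set (measurableTypeR R)) : (forall i, measurable (A i)) ->
  measurable [set v : 'rV[R]_N | forall i, A i (v ord0 i)].
Proof.
move=> mA; rewrite (_ : mkset _ = \bigcap_(i in [set: 'I_N])
    (@rV_coord R N i @^-1` A i)).
  apply: fin_bigcap_measurable => // i _.
  by rewrite -[X in measurable X]setTI; exact: (@measurable_rV_coord R N i measurableT _ (mA i)).
by apply/seteqP; split => v /= h i; [move=> _; exact: h|exact: (h i I)].
Qed.

Lemma ball_rVP (x y : 'rV[R]_N) (e : R) : 0 < e ->
  (forall i, `|x ord0 i - y ord0 i| < e) -> ball x e y.
Proof. by move=> e0 xy; split => // i j; rewrite ord1; exact: xy. Qed.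

(** An open set is the union of the boxes with rational centres and radii [1 /
    (k + 1)] that it contains, and there are countably many of these. *)
Lemma open_measurable_rV U : open U -> measurable U.
Proof.
move=> oU.
pose box (qk : 'rV[rat]_N * nat) := [set v : 'rV[R]_N | forall i,
  ball (ratr (qk.1 ord0 i) : R) qk.2.+1%:R^-1 (v ord0 i)].
pose F qk := box qk `&` [set _ | box qk `<=` U].
rewrite (_ : U = \bigcup_qk F qk).
  apply: countable_bigcupT_measurable => [|qk]; first exact: countableP.
  have [qkU|qkU] := pselect (box qk `<=` U); last first.
    by rewrite (_ : F qk = set0)// -subset0 => x [_ /qkU].
  rewrite (_ : F qk = box qk); last by apply/seteqP; split => [x []|].
  apply: (@measurable_rV_box
    (fun i => ball (ratr (qk.1 ord0 i) : R) qk.2.+1%:R^-1)) => i.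
  exact: measurable_ball.
apply/seteqP; split => [x Ux|x [qk _ [qx]]]; last exact.
move: oU; rewrite openE => /(_ x Ux)/nbhs_ballP[e /= e0 eU].
have [k ke] : exists k : nat, k.+1%:R^-1 < e / 2.
  have e20 : 0 < e / 2 by rewrite divr_gt0.
  have := near_infty_natSinv_lt (PosNum e20) => -[k _ /(_ k (leqnn k)) h].
  by exists k.
have k0 : 0 < k.+1%:R^-1 :> R by rewrite invr_gt0.
have [q qx] : {q : 'rV[rat]_N | forall i, `|ratr (q ord0 i) - x ord0 i| < k.+1%:R^-1}.
  have /(_ _)/cid-/all_sig[q qx] : forall i, exists r : rat, `|ratr r - x ord0 i| < k.+1%:R^-1.
    move=> i; have [|r] := @rat_in_itvoo R (x ord0 i - k.+1%:R^-1) (x ord0 i + k.+1%:R^-1).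
      by rewrite ltrD2l gt0_cp.
    by rewrite in_itv/= => /andP[h1 h2]; exists r; rewrite ltr_norml ltrBrDl h1 ltrBlDl.
  by exists (\row_i q i) => i; rewrite mxE.
have qU : box (q, k) `<=` U.
  move=> v /= vq; apply: eU; apply: ball_rVP => // i.
  have := vq i; have := qx i; rewrite /ball/= distrC => h1 h2.
  rewrite (le_lt_trans (ler_distD (ratr (q ord0 i)) _ _))// (splitr e).
  by rewrite ltrD// (lt_trans _ ke).
by exists (q, k) => //; split => //= i; rewrite /ball/=; exact: qx.
Qed.

Lemma continuous_measurable_rV g : continuous g -> measurable_fun setT g.
Proof.
move=> cg.
apply: (measurability _ (RGenOpens.measurableE R)).
move=> _ [_ [a [b ->]] <-]; rewrite setTI.
apply: open_measurable_rV; apply: open_comp; last exact: interval_open.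
by move=> x _; exact: cg.
Qed.

Lemma bounded_coord U : bounded_set U -> exists2 M : R, 0 < M &
  forall x, U x -> forall i, `|x ord0 i| <= M.
Proof.
move=> [M [_ UM]]; exists (Num.max 1 (M + 1)).
  by rewrite lt_max ltr01.
move=> x Ux i; have : `|x| <= Num.max 1 (M + 1).
  by apply: (UM (Num.max 1 (M + 1))) => //; rewrite lt_max ltrDl ltr01 orbT.
apply: le_trans; rewrite [leRHS]mx_normrE.
by apply: (le_bigmax _ _ (ord0, i)).
Qed.

Lemma lebesgue_rV_bounded U : measurable U -> bounded_set U ->
  (lebesgue_rV R N U < +oo)%E.
Proof.
move=> mU /bounded_coord[M M0 UM].
pose I : 'I_N -> set (measurableTypeR R) := fun=> `[(- M), M]%classic.
have mI i : measurable (I i) by exact: measurable_itv.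
apply: (@le_lt_trans _ _ (lebesgue_rV R N [set v | forall i, I i (v ord0 i)])).
  apply: le_measure; rewrite ?inE//; first exact: measurable_rV_box.
  by move=> x Ux i; rewrite /I/= in_itv/= -ler_norml; exact: UM.
rewrite lebesgue_rV_box//.
rewrite ltey_eq; apply/orP; left.
elim/big_ind: _ => [//|x y|i _]; first exact: fin_numM.
by rewrite lebesgue_measure_itv/=; case: ifP.
Qed.
End borel_rV.

(** * Test functions *)

Section smooth_functions.
Context (R : realType) (N : nat).
Implicit Types (g h : 'rV[R]_N -> R) (Omega : set 'rV[R]_N) (i : 'I_N).

Lemma smooth_continuous g : smooth g -> continuous g.
Proof. by move=> /(_ [::])[]. Qed.

Lemma smooth_derivable g x i : smooth g -> derivable g x (delta_mx ord0 i).
Proof. by move=> /(_ [::])[_]; apply. Qed.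

Lemma smooth_partial g i : smooth g -> continuous (partial i g).
Proof. by move=> /(_ [:: i])[]. Qed.

Lemma partial_lin (a b : R) g h i x :
  derivable g x (delta_mx ord0 i) -> derivable h x (delta_mx ord0 i) ->
  partial i (fun y => a * g y + b * h y) x = a * partial i g x + b * partial i h x.
Proof.
move=> dg dh; rewrite /partial.
have -> : (fun y => a * g y + b * h y) = (a \*: g) + (b \*: h) by [].
by rewrite deriveD ?deriveZ//; exact: derivableZ.
Qed.

Lemma smooth_lin (a b : R) g h : smooth g -> smooth h ->
  smooth (fun y => a * g y + b * h y).
Proof.
move=> sg sh s.
have -> : foldr (@partial R N) (fun y => a * g y + b * h y) s =
    fun y => a * foldr (@partial R N) g s y + b * foldr (@partial R N) h s y.
  elim: s => //= i s ->; apply/funext => x.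
  by rewrite partial_lin//; [case: (sg s)|case: (sh s)].
have [[cg dg] [ch dh]] := (sg s, sh s); split.
  move=> x; apply: (@continuousD _ _ _ (fun y => a * _ y) (fun y => b * _ y));
    apply: (@continuousM _ _ (fun=> _)); [exact: cst_continuous|exact: cg| |exact: ch].
  exact: cst_continuous.
move=> x i; have -> : (fun y => a * foldr (@partial R N) g s y +
    b * foldr (@partial R N) h s y) =
  (a \*: foldr (@partial R N) g s) + (b \*: foldr (@partial R N) h s) by [].
by apply: derivableD; apply: derivableZ.
Qed.

Lemma supp_lin (a b : R) g h :
  supp (fun y => a * g y + b * h y) `<=` supp g `|` supp h.
Proof.
rewrite /supp -closureU; apply: closure_subset => x /=.
have [->|g0] := eqVneq (g x) 0; last by left.
by rewrite mulr0 add0r mulf_eq0 negb_or => /andP[_]; right.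
Qed.

Lemma test_function_lin (a b : R) Omega g h :
  test_function Omega g -> test_function Omega h ->
  test_function Omega (fun y => a * g y + b * h y).
Proof.
move=> [sg cg gO] [sh ch hO]; split; first exact: smooth_lin.
  apply: (subclosed_compact _ (compactU cg ch)); first exact: closed_closure.
  exact: supp_lin.
by apply: subset_trans (@supp_lin _ _ _ _) _; rewrite subUset.
Qed.

Lemma gradient_lin (a b : R) g h x : smooth g -> smooth h ->
  gradient (fun y => a * g y + b * h y) x = a *: gradient g x + b *: gradient h x.
Proof.
move=> sg sh; apply/rowP => i; rewrite !mxE partial_lin//.
  exact: smooth_derivable.
exact: smooth_derivable.
Qed.

Lemma test_function_eq0 Omega g x : test_function Omega g -> ~ Omega x -> g x = 0.
Proof.
move=> [_ _ gO] Ox; apply/eqP; apply: contrapT => /negP gx; apply/Ox/gO.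
exact: subset_closure.
Qed.

(** The complement of the support is open, so that [g] vanishes near [x]. *)
Lemma test_function_partial_eq0 Omega g i x :
  test_function Omega g -> ~ Omega x -> partial i g x = 0.
Proof.
move=> [_ _ gO] Ox; have oC : open (~` supp g).
  by apply: closed_openC; exact: closed_closure.
have Cx : (~` supp g) x by move=> /gO.
rewrite /partial (@near_eq_derive _ _ _ g (cst 0)) ?derive_cst//.
have := open_nbhs_nbhs (conj oC Cx); apply: filterS => y /= gy.
by apply/eqP; apply: contrapT => /negP gy0; apply/gy/subset_closure.
Qed.

Lemma continuous_bounded_on Omega g : bounded_set Omega -> continuous g ->
  exists B : R, forall x, Omega x -> `|g x| <= B.
Proof.
move=> bO cg; have [Mb Mb0 OM] := bounded_coord bO.
pose K := [set x : 'rV[R]_N | forall i, `[(- Mb), Mb]%classic (x ord0 i)].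
have cK : compact K.
  apply: (@rV_compact _ _ (fun=> `[(- Mb), Mb]%classic)) => i.
  exact: segment_compact.
have OK : Omega `<=` K.
  by move=> x Ox i; rewrite /= in_itv/= -ler_norml; exact: OM.
have [M [_ KM]] : bounded_set (g @` K).
  by apply/compact_bounded/continuous_compact => //; exact: continuous_subspaceT.
exists (M + 1) => x Ox; apply: (KM (M + 1)); first by rewrite ltrDl.
by exists x => //; exact: OK.
Qed.

Lemma LpOn_continuous Omega g (p : R) : 0 <= p -> open Omega -> bounded_set Omega ->
  continuous g -> LpOn (lebesgue_rV R N) Omega p g.
Proof.
move=> p0 oO bO cg; have mO := open_measurable_rV oO.
have mg : measurable_fun Omega g.
  by apply: measurable_funTS; exact: continuous_measurable_rV.
have [B gB] := continuous_bounded_on bO cg.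
apply: (@LpOn_le _ _ _ _ _ mO p g (cst B)) => //.
  by move=> x Ox /=; rewrite (le_trans (gB x Ox))// ler_norm.
split=> //; apply/integrableP; split=> //.
  by apply/measurable_EFinP/measurable_powR_normr; exact: measurable_cst.
under eq_integral do rewrite /=.
rewrite integral_cst// lte_mul_pinfty//.
exact: lebesgue_rV_bounded.
Qed.

End smooth_functions.

(** * The Poincare inequality for test functions *)

Section poincare_line.
Context (R : realType) (p : R).
Context (p1 : 1 < p).
Local Notation leb := (@lebesgue_measure R).

Let p0 : 0 < p. Proof. by rewrite (lt_trans ltr01). Qed.

(** Bernoulli's inequality at [s / c]: the graph of [s ^ p] lies above its
    tangent at [c]. *)
Lemma powR_tangent (c s : R) : 0 <= c -> 0 <= s ->
  c `^ p + p * c `^ (p - 1) * (s - c) <= s `^ p.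
Proof.
move=> c0 s0; have [->|cN0] := eqVneq c 0.
  by rewrite !powR0 ?mulr0 ?mul0r ?addr0 ?powR_ge0// gt_eqF// subr_gt0.
have {c0}cN0 : 0 < c by rewrite lt0r cN0.
have := powR_bernoulli p1 (divr_ge0 s0 (ltW cN0)).
rewrite -(ler_pM2l (powR_gt0 p cN0)) -powRM ?(ltW cN0) ?divr_ge0 ?(ltW cN0)//.
rewrite [c * (s / c)]mulrC divfK ?gt_eqF//.
have : c * c `^ (p - 1) = c `^ p by rewrite mulr_powRB1// ltW.
move=> cE; apply: le_trans; rewrite -cE.
have -> : s / c - 1 = (s - c) / c by field; rewrite gt_eqF.
by rewrite le_eqVlt; apply/orP; left; apply/eqP; field; rewrite gt_eqF.
Qed.

Lemma integrable_continuous_itv (a b : R) (f : R -> R) : continuous f ->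
  leb.-integrable `[a, b] (EFin \o f).
Proof.
move=> cf; apply: continuous_compact_integrable; first exact: segment_compact.
exact: continuous_subspaceT.
Qed.

(** The tangent inequality of [s ^ p] at the mean value [c] of [|f|], integrated
    over the interval. *)
Lemma jensen_powR (a b : R) (f : R -> R) : a < b -> continuous f ->
  (\int[leb]_(x in `[a, b]) `|f x|) `^ p <=
  (b - a) `^ (p - 1) * \int[leb]_(x in `[a, b]) (`|f x| `^ p).
Proof.
move=> ab cf; set I := (X in X `^ p); set A := (X in _ * X).
have L0 : 0 < b - a by rewrite subr_gt0.
have I0 : 0 <= I by apply: Rintegral_ge0.
pose c := I / (b - a); have c0 : 0 <= c by rewrite divr_ge0 ?(ltW L0).
have mab : measurable (`[a, b]%classic : set (measurableTypeR R)) by exact: measurable_itv.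
have muab : fine (leb `[a, b]%classic) = b - a.
  by rewrite lebesgue_measure_itv/= lte_fin ab.
have cnf : continuous (fun x => `|f x|).
  by move=> x; apply: cvg_norm; exact: cf.
have In : leb.-integrable `[a, b] (EFin \o (fun x => `|f x|)).
  exact: integrable_continuous_itv.
have Ip : leb.-integrable `[a, b] (EFin \o (fun x => `|f x| `^ p)).
  apply: integrable_continuous_itv => x.
  by apply: cvg_powR => //; exact: cnf.
have Ic (k : R) : leb.-integrable `[a, b] (EFin \o cst k).
  by apply: integrable_continuous_itv; exact: cst_continuous.
have : \int[leb]_(x in `[a, b]) (c `^ p + p * c `^ (p - 1) * (`|f x| - c)) <= A.
  apply: le_Rintegral => //; last by move=> x _; exact: powR_tangent.
  apply: integrable_EFinD => //; first exact: Ic.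
  apply: integrable_EFinZ => //; apply: integrable_EFinD => //; exact: Ic.
rewrite RintegralD//; last 2 first.
- exact: Ic.
- by apply: integrable_EFinZ => //; apply: integrable_EFinD => //; exact: Ic.
rewrite RintegralZl//; last by apply: integrable_EFinD => //; exact: Ic.
rewrite RintegralB//; last exact: Ic.
rewrite !Rintegral_cst// muab -/I.
have -> : I - c * (b - a) = 0 by rewrite /c divfK ?gt_eqF// subrr.
rewrite mulr0 addr0 => cA.
have -> : I = (b - a) * c by rewrite mulrC divfK// gt_eqF.
rewrite powRM ?(ltW L0)// -(mulr_powRB1 (ltW L0) p0) -mulrA mulrCA ler_wpM2l ?powR_ge0//.
by rewrite mulrC.
Qed.

Lemma ftc_le_integral (a b t : R) (F f : R -> R) : a <= t -> t <= b ->
  (forall x : R, is_derive x 1 F (f x)) -> continuous f -> F a = 0 ->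
  `|F t| <= \int[leb]_(x in `[a, b]) `|f x|.
Proof.
move=> + tb dF cf Fa0; rewrite le_eqVlt => /predU1P[<-|at_].
  by rewrite Fa0 normr0 Rintegral_ge0.
have cF : continuous F.
  by move=> x; apply/differentiable_continuous/derivable1_diffP; case: (dF x).
have cnf : continuous (fun x => `|f x|).
  by move=> x; apply: cvg_norm; exact: cf.
have ftc : (\int[leb]_(x in `[a, t]) (f x)%:E = (F t)%:E)%E.
  rewrite (@continuous_FTC2 R f F a t at_) ?Fa0 ?sube0//.
  - exact: continuous_subspaceT.
  - split; first by move=> x _; case: (dF x).
      by apply: cvg_at_right_filter; exact: cF.
    by apply: cvg_at_left_filter; exact: cF.
  - by move=> x _; rewrite derive1E; case: (dF x).
have -> : F t = \int[leb]_(x in `[a, t]) f x by rewrite /Rintegral ftc.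
apply: le_trans (le_normr_Rintegral _ _) _ => //.
  exact: integrable_continuous_itv.
rewrite -lee_fin !EFin_Rintegral//; try exact: integrable_continuous_itv.
apply: ge0_subset_integral => //.
  apply/measurable_EFinP/measurable_funTS.
  exact: (@continuous_measurable_fun R (fun x => `|f x|)).
by apply: subset_itvl; rewrite bnd_simp.
Qed.

(** By the fundamental theorem of calculus [|F|] is at most the integral of
    [|f|] over [[a, b]], which Jensen's inequality compares with the integral
    of [|f| ^ p]. *)
Lemma poincare_line (a b : R) (F f : R -> R) : a < b ->
  (forall x : R, is_derive x 1 F (f x)) -> continuous f ->
  (forall x, ~~ (a < x < b) -> F x = 0) ->
  (\int[leb]_x (`|F x| `^ p)%:E <=
   ((b - a) `^ p)%:E * \int[leb]_x (`|f x| `^ p)%:E)%E.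
Proof.
move=> ab dF cf F0.
have L0 : 0 < b - a by rewrite subr_gt0.
have mab : measurable (`[a, b]%classic : set (measurableTypeR R)) by exact: measurable_itv.
have cpf : continuous (fun x => `|f x| `^ p).
  by move=> x; apply: cvg_powR => //; apply: cvg_norm; exact: cf.
have Ip : leb.-integrable `[a, b] (EFin \o (fun x => `|f x| `^ p)).
  exact: integrable_continuous_itv.
have cF : continuous F.
  by move=> x; apply/differentiable_continuous/derivable1_diffP; case: (dF x).
have mF : measurable_fun [set: R] (fun x => (`|F x| `^ p)%:E).
  apply/measurable_EFinP/measurable_powR_normr.
  exact: (@continuous_measurable_fun R F).
set A := \int[leb]_(x in `[a, b]) (`|f x| `^ p).
have FA x : `|F x| `^ p <= (b - a) `^ (p - 1) * A.
  have A0 : 0 <= A by apply: Rintegral_ge0 => ? _; exact: powR_ge0.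
  have [/andP[ax xb]|xab] := boolP (a < x < b); last first.
    rewrite F0// normr0 powR0 ?gt_eqF// mulr_ge0// powR_ge0//.
  apply: le_trans (jensen_powR ab cf).
  rewrite ge0_ler_powR ?(ltW p0) ?nnegrE ?Rintegral_ge0//.
  by apply: ftc_le_integral; rewrite ?(ltW ax) ?(ltW xb)// F0// ltxx.
have -> : (\int[leb]_x (`|F x| `^ p)%:E = \int[leb]_(x in `[a, b]) (`|F x| `^ p)%:E)%E.
  rewrite [RHS]integral_mkcond; apply: eq_integral => x _.
  rewrite patchE; case: ifPn => // /negP xab; rewrite F0 ?normr0 ?powR0 ?gt_eqF//.
  apply/negP => /andP[ax xb]; apply: xab; apply/mem_set => /=.
  by rewrite in_itv/= (ltW ax) (ltW xb).
apply: (@le_trans _ _ (\int[leb]_(x in `[a, b]) ((b - a) `^ (p - 1) * A)%:E)%E).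
  apply: ge0_le_integral => //.
  - exact: measurable_funTS.
  - by move=> x _; rewrite lee_fin.
rewrite integral_cst//= lebesgue_measure_itv/= lte_fin ab -EFinD -EFinM.
rewrite mulrAC [_ * (b - a)]mulrC mulr_powRB1 ?(ltW L0)// EFinM lee_wpmul2l//.
  by rewrite lee_fin powR_ge0.
rewrite EFin_Rintegral//; apply: ge0_subset_integral => //.
by apply/measurable_EFinP; exact: (@continuous_measurable_fun R (fun x => `|f x| `^ p)).
Qed.

End poincare_line.

Section poincare_space.
Context (R : realType) (n : nat) (p : R).
Context (p1 : 1 < p).
Local Notation leb := (@lebesgue_measure R).
Local Notation E := 'rV[R]_n.+1.
Local Notation e0 := (delta_mx ord0 ord0 : 'rV[R]_n.+1).

Let p0 : 0 < p. Proof. by rewrite (lt_trans ltr01). Qed.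

Lemma rV_consE (t : R) (y : 'rV[R]_n) :
  rV_cons (t : measurableTypeR R, y) = rV_cons (0 : measurableTypeR R, y) + t *: e0.
Proof.
apply/rowP => i; rewrite [RHS]mxE [X in _ + X]mxE [X in _ * X]mxE eqxx/=.
case: (unliftP ord0 i) => [j|] ->.
  by rewrite !rV_consS/= mulr0 addr0.
by rewrite !rV_cons0/= mulr1 add0r.
Qed.

Lemma is_derive_rV_line (phi : E -> R) (x : E) (t : R) :
  derivable phi (x + t *: e0) e0 ->
  is_derive t 1 (fun s : R => phi (x + s *: e0)) (partial ord0 phi (x + t *: e0)).
Proof.
move=> dphi.
have quotE : (fun h : R => h^-1 *: (((fun s : R => phi (x + s *: e0)) \o shift t) (h *: (1 : R)) -
      (fun s : R => phi (x + s *: e0)) t)) =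
    (fun h : R => h^-1 *: ((phi \o shift (x + t *: e0)) (h *: e0) - phi (x + t *: e0))).
  apply/funext => h /=; congr (_ *: (phi _ - _)).
  by rewrite scalerDl addrCA [h *: 1]mulr1.
split; first by rewrite /derivable quotE.
by rewrite /partial /derive quotE.
Qed.

Lemma continuous_rV_line (g : E -> R) (x : E) :
  continuous g -> continuous (fun s : R => g (x + s *: e0)).
Proof.
move=> cg s; apply: (@continuous_comp _ _ _ (fun s : R => x + s *: e0) g); last exact: cg.
by apply: cvgD; [exact: cvg_cst|apply: cvgZr_tmp; exact: cvg_id].
Qed.

Lemma integral_lebesgue_rVS (h : E -> \bar R) : measurable_fun setT h ->
  (forall x, 0 <= h x)%E ->
  (\int[lebesgue_rV R n.+1]_x h x =
   \int[lebesgue_rV R n]_y \int[leb]_t h (rV_cons (t : measurableTypeR R, y)))%E.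
Proof.
move=> mh h0.
have mc := @measurable_rV_cons R n.
have H := ge0_integral_pushforward mc (leb \x lebesgue_rV R n)%E measurableT mh (fun x _ => h0 x).
rewrite preimage_setT in H.
transitivity (\int[leb \x lebesgue_rV R n]_x (h \o @rV_cons R n) x)%E.
  rewrite -H; apply: eq_measure_integral => A mA _; reflexivity.
rewrite fubini_tonelli2//.
- by apply: measurableT_comp => //; exact: measurable_rV_cons.
- by move=> x; exact: h0.
Qed.

Lemma measurable_integral_rV_line (h : E -> \bar R) : measurable_fun setT h ->
  (forall x, 0 <= h x)%E ->
  measurable_fun setT (fun y : 'rV[R]_n =>
    \int[leb]_t h (rV_cons (t : measurableTypeR R, y)))%E.
Proof.
move=> mh h0.
apply: (@measurable_fun_fubini_tonelli_G _ _ _ _ _ leb (h \o @rV_cons R n)) => //.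
- by apply: measurableT_comp => //; exact: measurable_rV_cons.
- by move=> x; exact: h0.
Qed.

(** The one-dimensional inequality on every line parallel to the first axis,
    integrated over the other coordinates by Tonelli's theorem. *)
Lemma poincare_smooth (phi : E -> R) (M : R) : 0 < M -> smooth phi ->
  (forall x, phi x != 0 -> `|x ord0 ord0| < M) ->
  (\int[lebesgue_rV R n.+1]_x (`|phi x| `^ p)%:E <=
   ((2 * M) `^ p)%:E * \int[lebesgue_rV R n.+1]_x (`|partial ord0 phi x| `^ p)%:E)%E.
Proof.
move=> M0 sphi phiM.
have mpow (g : E -> R) : continuous g -> measurable_fun setT (fun x => (`|g x| `^ p)%:E).
  move=> cg; apply/measurable_EFinP/measurable_powR_normr.
  exact: continuous_measurable_rV.
have m1 := mpow _ (smooth_continuous sphi).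
have m2 := mpow _ (@smooth_partial _ _ phi ord0 sphi).
rewrite !integral_lebesgue_rVS//; try by move=> x; rewrite lee_fin powR_ge0.
have pow_ge0 (g : E -> R) x : (0 <= (`|g x| `^ p)%:E)%E by rewrite lee_fin powR_ge0.
have m2' := measurable_integral_rV_line m2 (pow_ge0 _).
rewrite -ge0_integralZl//; last 2 first.
- by move=> y _; apply: integral_ge0.
- by rewrite lee_fin powR_ge0.
apply: ge0_le_integral => //.
- by move=> y _; apply: integral_ge0.
- exact: (measurable_integral_rV_line m1 (pow_ge0 _)).
- exact: measurable_funeM.
move=> y _.
have -> : 2 * M = M - (- M) by lra.
under eq_integral do rewrite rV_consE.
under [in leRHS]eq_integral do rewrite rV_consE.
apply: poincare_line => //; first by lra.
- by move=> t; apply: is_derive_rV_line; exact: smooth_derivable.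
- by apply: continuous_rV_line; exact: smooth_partial.
move=> t tM; apply/eqP; apply: contraTT isT => /phiM.
by rewrite -rV_consE rV_cons0/= ltr_norml (negbTE tM).
Qed.

End poincare_space.

Section vector_fields.
Context (R : realType) (N : nat) (d : measure_display) (T : measurableType d).
Context (mu : {measure set T -> \bar R}) (D : set T) (mD : measurable D).
Implicit Types (F G : T -> 'rV[R]_N).

Lemma measurable_edot F G : (forall i, measurable_fun D (fun x => F x ord0 i)) ->
  (forall i, measurable_fun D (fun x => G x ord0 i)) ->
  measurable_fun D (fun x => edot (F x) (G x)).
Proof.
by move=> mF mG; apply: measurable_sum => i; apply: measurable_funM.
Qed.

Lemma measurable_enorm F : (forall i, measurable_fun D (fun x => F x ord0 i)) ->
  measurable_fun D (fun x => enorm (F x)).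
Proof.
move=> mF; rewrite /enorm.
under eq_fun do rewrite -powR12_sqrt ?edot_ge0//.
apply: (@measurableT_comp _ _ _ _ _ _ (@powR R ^~ 2^-1)) => //.
exact: measurable_edot.
Qed.

Lemma LpOn_enorm (p : R) F : 0 < p ->
  (forall i, LpOn mu D p (fun x => F x ord0 i)) ->
  LpOn mu D p (fun x => enorm (F x)).
Proof.
move=> p0 LF; have mF : measurable_fun D (fun x => enorm (F x)).
  by apply: measurable_enorm => i; case: (LF i).
apply: (LpOn_le mD (ltW p0) mF) (LpOn_sum mD (index_enum _) p0 (fun i => LpOn_norm mD (LF i))).
move=> x _; rewrite !ger0_norm ?enorm_ge0 ?sumr_ge0//.
exact: enorm_le_sum.
Qed.

Lemma energy_coord_le (p : R) F i : 0 < p ->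
  (forall i, LpOn mu D p (fun x => F x ord0 i)) ->
  energy mu D p (fun x => F x ord0 i) <= energy mu D p (fun x => enorm (F x)).
Proof.
move=> p0 LF; apply: energy_le => //; [exact: ltW|exact: LpOn_enorm|].
by move=> x _; rewrite [leRHS]ger0_norm ?enorm_ge0// ler_coord_enorm.
Qed.

End vector_fields.

Section poincare_test.
Context (R : realType) (N : nat) (p : R) (Omega : set 'rV[R]_N).
Context (p1 : 1 < p) (N0 : (0 < N)%N).
Context (oO : open Omega) (bO : bounded_set Omega).
Local Notation mu := (lebesgue_rV R N).

Let p0 : 0 < p. Proof. by rewrite (lt_trans ltr01). Qed.

Lemma LpOn_test r phi : 0 < r -> test_function Omega phi -> LpOn mu Omega r phi.
Proof.
by move=> r0 [sphi _ _]; apply: LpOn_continuous => //; [exact: ltW|exact: smooth_continuous].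
Qed.

Lemma LpOn_gradient_test r phi i : 0 < r -> test_function Omega phi ->
  LpOn mu Omega r (fun x => gradient phi x ord0 i).
Proof.
move=> r0 [sphi _ _]; under eq_fun do rewrite mxE.
by apply: LpOn_continuous => //; [exact: ltW|exact: smooth_partial].
Qed.

Lemma poincare_test : exists2 C : R, 0 < C & forall phi, test_function Omega phi ->
  energy mu Omega p phi <= C * energy mu Omega p (fun x => enorm (gradient phi x)).
Proof.
have mO := open_measurable_rV oO.
have := LpOn_gradient_test; have := LpOn_test; move: Omega oO bO mO.
case: N N0 => // n _ O oO' bO' mO' Lt Lg.
have [M M0 OM] := bounded_coord bO'.
(* [M + 1] turns the bound of [bounded_coord] into a strict one *)
exists ((2 * (M + 1)) `^ p).
  by rewrite powR_gt0// mulr_gt0// ltr_wpDl// ltW.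
move=> phi tphi; have [sphi _ _] := tphi.
apply: (@le_trans _ _ ((2 * (M + 1)) `^ p * energy (lebesgue_rV R n.+1) O p
    (fun x => gradient phi x ord0 ord0))); last first.
  rewrite ler_wpM2l ?powR_ge0//; apply: energy_coord_le => // i.
  exact: Lg.
have whole g : (forall x, ~ O x -> g x = 0) -> LpOn (lebesgue_rV R n.+1) O p g ->
    (energy (lebesgue_rV R n.+1) O p g)%:E =
    (\int[lebesgue_rV R n.+1]_x (`|g x| `^ p)%:E)%E.
  move=> g0 [_ Ig]; rewrite EFin_Rintegral// integral_mkcond.
  apply: eq_integral => x _; rewrite patchE; case: ifPn => // /negP xO.
  by rewrite g0 ?normr0 ?powR0 ?gt_eqF// => /mem_set.
have z1 x : ~ O x -> phi x = 0 by exact: test_function_eq0.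
have z2 x : ~ O x -> gradient phi x ord0 ord0 = 0.
  by move=> Ox; rewrite mxE; exact: test_function_partial_eq0 tphi Ox.
rewrite -lee_fin EFinM (whole _ z1 (Lt p phi p0 tphi)) (whole _ z2 (Lg p phi ord0 p0 tphi)).
under [in leRHS]eq_integral do rewrite mxE.
apply: poincare_smooth => //; first by rewrite ltr_wpDl// ltW.
move=> x phix; have Ox : O x.
  by apply: contrapT => /z1/eqP; apply/negP.
by rewrite (le_lt_trans (OM x Ox _))// ltrDl.
Qed.

End poincare_test.

(** * Integrals of powers of sums *)

Section energy_estimates.
Context d (T : measurableType d) (R : realType).
Context (mu : {measure set T -> \bar R}) (D : set T) (mD : measurable D).
Context (p : R) (p0 : 0 < p).
Implicit Types (f g h : T -> R).
Local Notation E := (energy mu D p).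
Local Notation L := (LpOn mu D p).

Lemma energy_lin_le (a b : R) f g h : L f -> L g -> L h ->
  (forall x, D x -> `|h x| <= `|a| * `|f x| + `|b| * `|g x|) ->
  E h <= 2 `^ p * (`|a| `^ p * E f + `|b| `^ p * E g).
Proof.
move=> Lf Lg Lh hfg.
have Laf : L (fun x => `|a| * `|f x|) by apply: LpOnZ => //; exact: LpOn_norm.
have Lbg : L (fun x => `|b| * `|g x|) by apply: LpOnZ => //; exact: LpOn_norm.
apply: (@le_trans _ _ (E (fun x => `|a| * `|f x| + `|b| * `|g x|))).
  apply: energy_le => //; [exact: ltW|exact: LpOnD|].
  by move=> x Dx; rewrite (le_trans (hfg x Dx))// ler_norm.
apply: le_trans (energyD_le mD p0 Laf Lbg) _.
rewrite !energyZ//; try exact: LpOn_norm.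
by rewrite !normr_id (@energy_norm _ _ _ mu D p f) (@energy_norm _ _ _ mu D p g).
Qed.

Lemma energy_triangle f g h : L f -> L g -> L h ->
  (forall x, D x -> `|h x| <= `|f x| + `|g x|) ->
  E h <= 2 `^ p * (E f + E g).
Proof.
move=> Lf Lg Lh hfg.
have := energy_lin_le (a := 1) (b := 1) Lf Lg Lh.
by rewrite normr1 powR1 !mul1r; apply => x Dx; rewrite !mul1r; exact: hfg.
Qed.

Lemma energy_sum_le (I : Type) (r : seq I) (F : I -> T -> R) :
  (forall i, L (F i)) ->
  E (fun x => \sum_(i <- r) F i x) <= (2 `^ p) ^+ size r * \sum_(i <- r) E (F i).
Proof.
move=> LF; elim: r => [|i r IH].
  under [X in energy _ _ _ X]eq_fun do rewrite big_nil.
  rewrite big_nil mulr0 /energy.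
  under eq_Rintegral do rewrite normr0 powR0 ?gt_eqF//.
  by rewrite Rintegral_cst// mul0r.
have two : 1 <= 2 `^ p :> R by rewrite -[leLHS](powRr0 2) ler_powR ?ler1n// ltW.
under [X in energy _ _ _ X]eq_fun do rewrite big_cons.
apply: le_trans (energyD_le mD p0 (LF i) (LpOn_sum mD r p0 LF)) _.
rewrite big_cons/= exprS -mulrA ler_pM2l ?powR_gt0// mulrDr lerD//.
by rewrite ler_peMl ?energy_ge0// exprn_ege1.
Qed.

Lemma energy_enorm_le N (F : T -> 'rV[R]_N) (e : R) :
  (forall i, L (fun x => F x ord0 i)) ->
  (forall i, E (fun x => F x ord0 i) <= e) ->
  E (fun x => enorm (F x)) <= (2 `^ p) ^+ N * (N%:R * e).
Proof.
move=> LF Fe.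
apply: (@le_trans _ _ (E (fun x => \sum_i `|F x ord0 i|))).
  apply: energy_le => //; [exact: ltW|exact: LpOn_enorm| |].
    by apply: LpOn_sum => // i; exact: LpOn_norm.
  by move=> x _; rewrite !ger0_norm ?enorm_ge0 ?sumr_ge0// enorm_le_sum.
apply: le_trans (energy_sum_le _ _) _ => [i|]; first exact: LpOn_norm.
have -> : size (index_enum 'I_N) = N by rewrite /index_enum unlock -enumT size_enum_ord.
rewrite ler_wpM2l ?exprn_ge0 ?powR_ge0//.
apply: (@le_trans _ _ (\sum_(i < N) e)); last by rewrite sumr_const card_ord mulr_natl.
by apply: ler_sum => i _; rewrite energy_norm.
Qed.

End energy_estimates.

(** * Sobolev functions vanishing on the boundary *)

Section Lp_restriction.
Context (R : realType) (N : nat) (Omega : set 'rV[R]_N).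
Context (mO : measurable Omega).
Local Notation mu := (lebesgue_rV R N).

Lemma LpP (r : R) (f : 'rV[R]_N -> R) : 1 <= r ->
  Lp r%:E Omega f <-> LpOn mu Omega r f.
Proof.
move=> r1; have r0 : 0 < r by rewrite (lt_le_trans ltr01).
have powE x : (`|(f \_ Omega) x| `^ r)%:E = ((fun x => (`|f x| `^ r)%:E) \_ Omega) x.
  by rewrite !patchE; case: ifP => //; rewrite normr0 powR0// gt_eqF.
split.
  move=> Lf; have If := Lfun_integrable r1 Lf; split.
    move: Lf; rewrite /Lp/= inE => /andP[]; rewrite inE/= => mf _.
    by apply/(measurable_restrictT _ mO).
  apply/(integrable_mkcond _ mO).
  by move: If; rewrite (_ : (fun x => _) = (fun x => (`|f x| `^ r)%:E) \_ Omega)//; apply/funext.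
move=> [mf If]; rewrite /Lp/= inE; apply/andP; split; rewrite inE/=.
  by apply/(measurable_restrictT _ mO).
rewrite /finite_norm unlock poweR_lty//.
under eq_integral do rewrite /= powE.
rewrite -integral_mkcond -EFin_Rintegral//; exact: ltry.
Qed.

Lemma Lnorm_restrict (r : R) (f : 'rV[R]_N -> R) : 1 <= r -> LpOn mu Omega r f ->
  ('N[mu]_(r%:E)[EFin \o (f \_ Omega)] = (energy mu Omega r f `^ r^-1)%:E)%E.
Proof.
move=> r1 [mf If]; have r0 : 0 < r by rewrite (lt_le_trans ltr01).
have powE x : (`|(f \_ Omega) x| `^ r)%:E = ((fun x => (`|f x| `^ r)%:E) \_ Omega) x.
  by rewrite !patchE; case: ifP => //; rewrite normr0 powR0// gt_eqF.
rewrite unlock; under eq_integral do rewrite /= powE.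
by rewrite -integral_mkcond -EFin_Rintegral// poweR_EFin.
Qed.

End Lp_restriction.

Section sobolev_space.
Context (R : realType) (N : nat) (p : R) (Omega : set 'rV[R]_N).
Context (p1 : 1 < p).
Context (oO : open Omega) (bO : bounded_set Omega).
Local Notation mu := (lebesgue_rV R N).
Local Notation E := (energy mu Omega p).
Local Notation L := (LpOn mu Omega p).
Local Notation W := (sobolev p Omega).
Implicit Types (u v w : sobolev p Omega).

Let p0 : 0 < p. Proof. by rewrite (lt_trans ltr01). Qed.
Let mO : measurable Omega. Proof. exact: open_measurable_rV. Qed.
Let q := p / (p - 1).
Let q0 : 0 < q. Proof. exact: conjugate_gt0. Qed.
Let pq : p^-1 + q^-1 = 1.
Proof. exact: inv_conjugate. Qed.

Lemma sobolev_LpOn u : L u.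
Proof. by apply/LpP; [exact: mO|exact: ltW|exact: sobolev_fun_Lp]. Qed.

Lemma grad_LpOn u i : L (fun x => grad u x ord0 i).
Proof. by apply/LpP; [exact: mO|exact: ltW|exact: grad_Lp]. Qed.

Lemma gradB_LpOn u v i : L (fun x => (grad u x - grad v x) ord0 i).
Proof. by under eq_fun do rewrite !mxE; apply: LpOnB => //; exact: grad_LpOn. Qed.

Lemma integrable_weak (g : 'rV[R]_N -> R) (h : 'rV[R]_N -> R) : L g ->
  continuous h -> mu.-integrable Omega (EFin \o (fun x => g x * h x)).
Proof.
move=> Lg ch; have Lh : LpOn mu Omega q h by apply: LpOn_continuous => //; exact: ltW.
apply: (integrable_pairing mO p0 q0 pq Lg Lh).
  by apply: measurable_funM; [case: Lg|case: Lh].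
by move=> x _; rewrite normrM.
Qed.

Lemma weak_gradient_lin (a b : R) u v :
  weak_gradient Omega (fun x => a * u x + b * v x)
    (fun x => a *: grad u x + b *: grad v x).
Proof.
move=> phi tphi i; have [sphi _ _] := tphi.
have cp := @smooth_partial _ _ phi i sphi; have cphi := smooth_continuous sphi.
have Iu := integrable_weak (sobolev_LpOn u) cp.
have Iv := integrable_weak (sobolev_LpOn v) cp.
have IGu := integrable_weak (grad_LpOn u i) cphi.
have IGv := integrable_weak (grad_LpOn v i) cphi.
transitivity (a * \int[mu]_(x in Omega) (u x * partial i phi x) +
              b * \int[mu]_(x in Omega) (v x * partial i phi x)).
  rewrite -!RintegralZl// -RintegralD//; try exact: integrable_EFinZ.
  by apply: eq_Rintegral => x _; rewrite mulrDl !mulrA.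
rewrite !gradP// !mulrN -opprD; congr (- _).
rewrite -!RintegralZl// -RintegralD//; try exact: integrable_EFinZ.
by apply: eq_Rintegral => x _; rewrite !mxE mulrDl !mulrA.
Qed.

Lemma sobolev_lin (a b : R) u v : exists w : W,
  sobolev_fun w = (fun x => a * u x + b * v x) /\
  grad w = (fun x => a *: grad u x + b *: grad v x).
Proof.
have Lw : Lp p%:E Omega (fun x => a * u x + b * v x).
  apply/LpP; [exact: mO|exact: ltW|].
  by apply: LpOnD => //; apply: LpOnZ => //; exact: sobolev_LpOn.
have LGw i : Lp p%:E Omega (fun x => (a *: grad u x + b *: grad v x) ord0 i).
  apply/LpP; [exact: mO|exact: ltW|].
  under eq_fun do rewrite !mxE.
  by apply: LpOnD => //; apply: LpOnZ => //; exact: grad_LpOn.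
by exists (Sobolev Lw LGw (weak_gradient_lin a b u v)).
Qed.

Lemma LpOn_testB u phi : test_function Omega phi -> L (fun x => phi x - u x).
Proof.
by move=> tphi; apply: LpOnB => //; [exact: LpOn_test|exact: sobolev_LpOn].
Qed.

Lemma LpOn_gradient_testB u phi i : test_function Omega phi ->
  L (fun x => (gradient phi x - grad u x) ord0 i).
Proof.
move=> tphi; under eq_fun do rewrite !mxE.
apply: LpOnB => //; last exact: grad_LpOn.
by have := LpOn_gradient_test oO bO i p0 tphi; under eq_fun do rewrite mxE.
Qed.

Lemma sobolev_norm_test u phi : test_function Omega phi ->
  sobolev_norm p Omega (fun x => phi x - u x) (fun x => gradient phi x - grad u x) =
  (E (fun x => phi x - u x) `^ p^-1 +
   \sum_(i < N) E (fun x => (gradient phi x - grad u x) ord0 i) `^ p^-1)%:E.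
Proof.
move=> tphi; rewrite /sobolev_norm (Lnorm_restrict mO (ltW p1) (LpOn_testB u tphi)).
rewrite EFinD -sumEFin; congr (_ + _)%E; apply: eq_bigr => i _.
by rewrite (Lnorm_restrict mO (ltW p1) (LpOn_gradient_testB u i tphi)).
Qed.

(** Equivalent to [W0], see [W0P]; the approximation by test functions is put in
    terms of [p]-th powers because the Poincare inequality is. *)
Definition approximable u := forall e : R, 0 < e ->
  exists phi, [/\ test_function Omega phi, E (fun x => phi x - u x) <= e &
    E (fun x => enorm (gradient phi x - grad u x)) <= e].

Lemma W0P u : W0 u <-> approximable u.
Proof.
split.
  move=> [phi tphi phiu] e e0.
  pose c := e / ((2 `^ p) ^+ N * N%:R + 1).
  have k0 : 0 <= (2 `^ p) ^+ N * N%:R :> R by rewrite mulr_ge0// exprn_ge0 ?powR_ge0.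
  have c0 : 0 < c by rewrite divr_gt0// ltr_wpDl.
  have cp0 : 0 < c `^ p^-1 by exact: powR_gt0.
  move: phiu; under eq_fun do rewrite sobolev_norm_test//.
  move=> /fine_cvgP[_] /cvgrPdist_lt/(_ _ cp0)[k _ /(_ k (leqnn k))] /=.
  rewrite sub0r normrN => /(le_lt_trans (ler_norm _)) small.
  have S0 : 0 <= \sum_(i < N) E (fun x => (gradient (phi k) x - grad u x) ord0 i) `^ p^-1.
    by apply: sumr_ge0 => i _; exact: powR_ge0.
  have back x : 0 <= x -> x `^ p^-1 < c `^ p^-1 -> x <= c.
    move=> x0 xc; rewrite leNgt; apply/negP => cx.
    by move: xc; rewrite ltNge ge0_ler_powR ?nnegrE ?invr_ge0 ?(ltW p0) ?(ltW c0) ?(ltW cx).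
  have h1 : E (fun x => phi k x - u x) <= c.
    by apply: back; [exact: energy_ge0|apply: le_lt_trans small; rewrite lerDl].
  have h2 i : E (fun x => (gradient (phi k) x - grad u x) ord0 i) <= c.
    apply: back; [exact: energy_ge0|apply: le_lt_trans small].
    rewrite (bigD1 i)//= addrCA lerDl addr_ge0 ?powR_ge0//.
    by apply: sumr_ge0 => j _; exact: powR_ge0.
  have ce : ((2 `^ p) ^+ N * N%:R + 1) * c = e by rewrite mulrC divfK// gt_eqF// ltr_wpDl.
  exists (phi k); split => //.
    by rewrite (le_trans h1)// -ce ler_peMl ?(ltW c0)// lerDr.
  apply: le_trans (energy_enorm_le mO p0 _ h2) _ => [i|]; first exact: LpOn_gradient_testB.
  by rewrite mulrA -ce ler_wpM2r ?(ltW c0)// lerDl.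
move=> au.
have /choice[phi phiP] : forall k : nat, exists phi, [/\ test_function Omega phi,
    E (fun x => phi x - u x) <= (k.+1%:R^-1) `^ p &
    E (fun x => enorm (gradient phi x - grad u x)) <= (k.+1%:R^-1) `^ p].
  by move=> k; apply: au; rewrite powR_gt0// invr_gt0.
exists phi => [k|]; first by case: (phiP k).
have tphi k : test_function Omega (phi k) by case: (phiP k).
under eq_fun do rewrite sobolev_norm_test//.
apply: cvg_EFin; first exact: nearW.
have root (x : R) k : 0 <= x -> x <= (k.+1%:R^-1) `^ p -> x `^ p^-1 <= k.+1%:R^-1.
  move=> x0 xk; have -> : k.+1%:R^-1 = (k.+1%:R^-1 `^ p) `^ p^-1 :> R.
    by rewrite -powRrM mulfV ?gt_eqF// powRr1.
  by rewrite ge0_ler_powR ?nnegrE ?invr_ge0 ?(ltW p0) ?powR_ge0.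
apply: (@squeeze_cvgr _ _ _ _ (cst 0) (fun k : nat => (1 + N%:R) * k.+1%:R^-1)).
- apply: nearW => k /=; rewrite addr_ge0 ?powR_ge0 ?sumr_ge0//=; last first.
    by move=> i _; exact: powR_ge0.
  have [_ h1 h2] := phiP k; rewrite mulrDl mul1r lerD//.
    by apply: root => //; exact: energy_ge0.
  apply: (@le_trans _ _ (\sum_(i < N) k.+1%:R^-1)).
    apply: ler_sum => i _; apply: root; first exact: energy_ge0.
    apply: le_trans h2.
    apply: (@energy_coord_le _ _ _ _ mu _ mO p
      (fun x => gradient (phi k) x - grad u x) i p0) => j.
    exact: LpOn_gradient_testB.
  by rewrite sumr_const card_ord mulr_natl.
- exact: cvg_cst.
- rewrite -[X in _ --> X](mulr0 (1 + N%:R)); apply: cvgM; first exact: cvg_cst.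
  exact: cvg_harmonic.
Qed.

End sobolev_space.

(** * Poincare inequality and completeness of the Sobolev space *)

Section sobolev_completeness.
Context (R : realType) (N : nat) (p : R) (Omega : set 'rV[R]_N).
Context (p1 : 1 < p) (N0 : (0 < N)%N).
Context (oO : open Omega) (bO : bounded_set Omega).
Local Notation mu := (lebesgue_rV R N).
Local Notation E := (energy mu Omega p).
Local Notation L := (LpOn mu Omega p).
Local Notation W := (sobolev p Omega).
Implicit Types (u v w : sobolev p Omega).

Let p0 : 0 < p. Proof. by rewrite (lt_trans ltr01). Qed.
Let mO : measurable Omega. Proof. exact: open_measurable_rV. Qed.
Let q := p / (p - 1).
Let q0 : 0 < q. Proof. exact: conjugate_gt0. Qed.
Let pq : p^-1 + q^-1 = 1.
Proof. exact: inv_conjugate. Qed.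

Lemma enorm_grad_LpOn u : L (fun x => enorm (grad u x)).
Proof. by apply: LpOn_enorm => // i; exact: grad_LpOn. Qed.

Lemma enorm_gradB_LpOn u v : L (fun x => enorm (grad u x - grad v x)).
Proof. by apply: LpOn_enorm => // i; exact: gradB_LpOn. Qed.

Lemma enorm_gradient_testB_LpOn u phi : test_function Omega phi ->
  L (fun x => enorm (gradient phi x - grad u x)).
Proof. by move=> tphi; apply: LpOn_enorm => // i; exact: LpOn_gradient_testB. Qed.

Lemma W0_lin (a b : R) u v w : W0 u -> W0 v ->
  sobolev_fun w = (fun x => a * u x + b * v x) ->
  grad w = (fun x => a *: grad u x + b *: grad v x) -> W0 w.
Proof.
move=> /(W0P p1 oO bO) Wu /(W0P p1 oO bO) Wv wE GE; apply/(W0P p1 oO bO) => e e0.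
pose K := 2 `^ p * (`|a| `^ p + `|b| `^ p) + 1.
have K1 : 0 <= 2 `^ p * (`|a| `^ p + `|b| `^ p) by rewrite mulr_ge0 ?addr_ge0 ?powR_ge0.
have K0 : 0 < K by rewrite ltr_wpDl.
have e'0 : 0 < e / K by rewrite divr_gt0.
have [phi [tphi phi1 phi2]] := Wu _ e'0.
have [psi [tpsi psi1 psi2]] := Wv _ e'0.
have tw := test_function_lin a b tphi tpsi.
have fin x y : x <= e / K -> y <= e / K ->
    2 `^ p * (`|a| `^ p * x + `|b| `^ p * y) <= e.
  move=> xe ye; have -> : e = K * (e / K) by rewrite mulrC divfK// gt_eqF.
  apply: (@le_trans _ _ (2 `^ p * (`|a| `^ p + `|b| `^ p) * (e / K))).
    by rewrite -mulrA mulrDl ler_wpM2l ?powR_ge0// lerD// ler_wpM2l ?powR_ge0.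
  by rewrite ler_wpM2r ?(ltW e'0)// lerDl.
have [sphi _ _] := tphi; have [spsi _ _] := tpsi.
exists (fun y => a * phi y + b * psi y); split => //.
  apply: le_trans (fin _ _ phi1 psi1); apply: energy_lin_le => //.
  - exact: LpOn_testB.
  - exact: LpOn_testB.
  - exact: LpOn_testB.
  move=> x _; rewrite wE -!normrM; apply: le_trans (ler_normD _ _).
  by rewrite le_eqVlt; apply/orP; left; apply/eqP; congr `|_|; ring.
apply: le_trans (fin _ _ phi2 psi2); apply: energy_lin_le => //.
- exact: enorm_gradient_testB_LpOn.
- exact: enorm_gradient_testB_LpOn.
- exact: enorm_gradient_testB_LpOn.
move=> x _; rewrite !(ger0_norm (enorm_ge0 _)) gradient_lin// GE -!enormZ.
apply: le_trans (enormD _ _); rewrite !scalerBr addrACA -opprD.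
exact: lexx.
Qed.

(** Both sides of the inequality for test functions pass to the limit, at the
    price of a larger constant: sums of [p]-th powers satisfy the triangle
    inequality up to the factor [2 ^ p]. *)
Lemma poincare_W0 : exists2 C : R, 0 < C &
  forall u, W0 u -> E u <= C * E (fun x => enorm (grad u x)).
Proof.
have [C C0 poincare] := poincare_test p1 N0 oO bO.
have two0 : 0 < 2 `^ p :> R by exact: powR_gt0.
exists (2 `^ p * (C * 2 `^ p)); first by rewrite !mulr_gt0.
move=> u /(W0P p1 oO bO) Wu; apply/ler_addgt0Pr => e e0.
pose K := 2 `^ p * (1 + C * 2 `^ p).
have K0 : 0 < K by rewrite mulr_gt0// addr_gt0// mulr_gt0.
have [phi [tphi phi1 phi2]] := Wu _ (divr_gt0 e0 K0).
have eK : e = K * (e / K) by rewrite mulrC divfK// gt_eqF.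
have h1 : E u <= 2 `^ p * (E (fun x => phi x - u x) + E phi).
  have Lphi := LpOn_test oO bO p0 tphi.
  apply: (energy_triangle mO p0 (LpOn_testB p1 oO bO u tphi) Lphi (sobolev_LpOn p1 oO u)) => x _.
  by rewrite distrC -[X in `|X| <= _](subrK (phi x)) ler_normD.
have h2 : E (fun x => enorm (gradient phi x)) <=
    2 `^ p * (E (fun x => enorm (gradient phi x - grad u x)) + E (fun x => enorm (grad u x))).
  have Lgphi : L (fun x => enorm (gradient phi x)).
    by apply: LpOn_enorm => // i; exact: LpOn_gradient_test.
  apply: (energy_triangle mO p0 (enorm_gradient_testB_LpOn u tphi)
    (enorm_grad_LpOn u) Lgphi) => x _; apply: ler_norm_enorm.
  by rewrite -[X in enorm X <= _](subrK (grad u x)) enormD.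
have h3 := poincare _ tphi.
move: h1 h2 h3 phi1 phi2; rewrite [in X in _ -> _ -> _ -> _ -> _ -> X]eK /K.
move: (E u) (E phi) (E (fun x => phi x - u x)) (e / K) => y1 y2 y3 e'.
move: (E _) (E _) (E _) => z1 z2 z3 h1 h2 h3 h4 h5.
have -> : 2 `^ p * (C * 2 `^ p) * z1 + 2 `^ p * (1 + C * 2 `^ p) * e' =
    2 `^ p * (e' + C * (2 `^ p * (e' + z1))) by ring.
rewrite (le_trans h1)// ler_pM2l// lerD// (le_trans h3)// ler_pM2l//.
by rewrite (le_trans h2)// ler_pM2l// lerD2r.
Qed.

(** Integration against [phi] and its derivatives is continuous on [L^p], since
    these functions are bounded and [Omega] has finite measure. *)
Lemma weak_gradient_limit (u_ : nat -> W) (g : 'rV[R]_N -> R) (G : 'rV[R]_N -> 'rV[R]_N) :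
  L g -> (forall i, L (fun x => G x ord0 i)) ->
  (forall e, 0 < e -> exists k, E (fun x => g x - u_ k x) <= e /\
    forall i, E (fun x => G x ord0 i - grad (u_ k) x ord0 i) <= e) ->
  weak_gradient Omega g G.
Proof.
move=> Lg LG uG phi tphi i; have [sphi _ _] := tphi.
have cp := @smooth_partial _ _ phi i sphi; have cphi := smooth_continuous sphi.
have Lp' : LpOn mu Omega q (partial i phi) by apply: LpOn_continuous => //; exact: ltW.
have Lphi : LpOn mu Omega q phi by apply: LpOn_continuous => //; exact: ltW.
apply/eqP; rewrite -subr_eq0 opprK -normr_le0; apply/ler_addgt0Pr => e e0.
rewrite add0r.
have e20 : 0 < e / 2 by rewrite divr_gt0.
have [r1 r10 small1] := pairing_small mO p0 q0 pq Lp' e20.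
have [r2 r20 small2] := pairing_small mO p0 q0 pq Lphi e20.
have r0 : 0 < Num.min r1 r2 by rewrite lt_min r10.
have [k [k1 k2]] := uG _ r0.
have Lgu : L (fun x => g x - u_ k x) by apply: LpOnB => //; exact: sobolev_LpOn.
have LGu : L (fun x => G x ord0 i - grad (u_ k) x ord0 i).
  by apply: LpOnB => //; exact: grad_LpOn.
have d1 : \int[mu]_(x in Omega) (g x * partial i phi x) =
    \int[mu]_(x in Omega) ((g x - u_ k x) * partial i phi x) +
    \int[mu]_(x in Omega) (u_ k x * partial i phi x).
  have I1 := integrable_weak p1 oO bO Lgu cp.
  have I2 := integrable_weak p1 oO bO (sobolev_LpOn p1 oO (u_ k)) cp.
  by rewrite -RintegralD//; apply: eq_Rintegral => x _; rewrite -mulrDl subrK.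
have d2 : \int[mu]_(x in Omega) (G x ord0 i * phi x) =
    \int[mu]_(x in Omega) ((G x ord0 i - grad (u_ k) x ord0 i) * phi x) +
    \int[mu]_(x in Omega) (grad (u_ k) x ord0 i * phi x).
  have I1 := integrable_weak p1 oO bO LGu cphi.
  have I2 := integrable_weak p1 oO bO (grad_LpOn p1 oO (u_ k) i) cphi.
  by rewrite -RintegralD//; apply: eq_Rintegral => x _; rewrite -mulrDl subrK.
rewrite d1 d2 gradP// addrACA addNr addr0 (splitr e).
apply: le_trans (ler_normD _ _) _; apply: lerD.
  apply: (small1 (fun x => g x - u_ k x)) => //.
  - by rewrite (le_trans k1)// ge_min lexx.
  - by apply: measurable_funM; [case: Lgu|case: Lp'].
  - by move=> x _; rewrite normrM.
apply: (small2 (fun x => G x ord0 i - grad (u_ k) x ord0 i)) => //.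
- by rewrite (le_trans (k2 i))// ge_min lexx orbT.
- by apply: measurable_funM; [case: LGu|case: Lphi].
- by move=> x _; rewrite normrM.
Qed.

(** The function and each component of the gradient converge in [L^p]; the
    limits form a Sobolev function by [weak_gradient_limit], and a test
    function close to [u_ k] is close to the limit. *)
Lemma sobolev_complete (u_ : nat -> W) : (forall k, W0 (u_ k)) ->
  (forall k l, (k <= l)%N -> E (fun x => u_ k x - u_ l x) <= rate p k) ->
  (forall k l, (k <= l)%N ->
    E (fun x => enorm (grad (u_ k) x - grad (u_ l) x)) <= rate p k) ->
  exists u, [/\ W0 u, forall k, E (fun x => u x - u_ k x) <= rate p k,
    forall k, E (fun x => enorm (grad u x - grad (u_ k) x)) <=
      (2 `^ p) ^+ N * N%:R * rate p k &
    {ae mu, forall x, Omega x -> u_ k x @[k --> \oo] --> u x}].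
Proof.
move=> Wu uf Gf.
have [g [Lg gu g_ae]] := LpOn_complete mO p0 (fun k => sobolev_LpOn p1 oO (u_ k)) uf.
have : forall i, exists h, L h /\
    forall k, E (fun x => h x - grad (u_ k) x ord0 i) <= rate p k.
  move=> i; have [|h [Lh hG _]] := LpOn_complete mO p0 (fun k => grad_LpOn p1 oO (u_ k) i).
    move=> k l kl; apply: le_trans (Gf k l kl).
    apply: le_trans (energy_coord_le mO i p0 (gradB_LpOn p1 oO (u_ k) (u_ l))).
    by rewrite le_eqVlt; apply/orP; left; apply/eqP; apply: eq_Rintegral => x _; rewrite !mxE.
  by exists h.
move=> /choice[h hP].
pose G x : 'rV[R]_N := \row_i h i x.
have LG i : L (fun x => G x ord0 i) by under eq_fun do rewrite mxE; case: (hP i).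
have Gu i k : E (fun x => G x ord0 i - grad (u_ k) x ord0 i) <= rate p k.
  by under [X in energy _ _ _ X]eq_fun do rewrite mxE; case: (hP i).
have wG : weak_gradient Omega g G.
  apply: (@weak_gradient_limit u_) => // e e0.
  have [K /(_ K (leqnn K)) Ke] := rate_small p0 e0.
  by exists K; split => [|i]; [exact: le_trans (gu K) Ke|exact: le_trans (Gu i K) Ke].
have Lg' : Lp p%:E Omega g by apply/LpP => //; exact: ltW.
have LG' i : Lp p%:E Omega (fun x => G x ord0 i) by apply/LpP => //; exact: ltW.
pose u := Sobolev Lg' LG' wG.
have Gu' k : E (fun x => enorm (grad u x - grad (u_ k) x)) <= (2 `^ p) ^+ N * N%:R * rate p k.
  rewrite -mulrA; apply: energy_enorm_le => // i; first exact: gradB_LpOn.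
  by apply: le_trans (Gu i k); under [X in energy _ _ _ X <= _]eq_fun do rewrite !mxE;
    rewrite le_eqVlt; apply/orP; left; apply/eqP; apply: eq_Rintegral => x _; rewrite !mxE.
exists u; split => //.
apply/(W0P p1 oO bO) => e e0.
pose M : R := (2 `^ p) ^+ N * N%:R + 1.
have M1 : 0 <= (2 `^ p) ^+ N * N%:R :> R by rewrite mulr_ge0 ?exprn_ge0 ?powR_ge0.
have M0 : 0 < M by rewrite ltr_wpDl.
have two0 : 0 < 2 `^ p :> R by exact: powR_gt0.
have e'0 : 0 < e / 2 `^ p / 2 by rewrite !divr_gt0.
have [K /(_ K (leqnn K)) Ke] := rate_small p0 (divr_gt0 e'0 M0).
have /(W0P p1 oO bO)/(_ _ e'0)[phi [tphi phi1 phi2]] := Wu K.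
have fin x y : x <= e / 2 `^ p / 2 -> y <= M * rate p K -> 2 `^ p * (x + y) <= e.
  move=> xe yK; rewrite mulrC -ler_pdivlMr// [leRHS]splitr lerD//.
  by rewrite (le_trans yK)// mulrC -ler_pdivlMr.
have lin x y z : `|x - z| <= `|x - y| + `|z - y| :> R.
  by rewrite [`|z - y|]distrC ler_distD.
exists phi; split => //.
  have h1 := energy_triangle mO p0 (LpOn_testB p1 oO bO (u_ K) tphi)
    (LpOnB mO p0 Lg (sobolev_LpOn p1 oO (u_ K))) (LpOn_testB p1 oO bO u tphi).
  apply: le_trans (h1 _) (fin _ _ phi1 _).
    by move=> x _; exact: lin.
  by rewrite (le_trans (gu K))// ler_peMl ?(ltW (rate_gt0 _ _))// lerDr.
have h1 := energy_triangle mO p0 (enorm_gradient_testB_LpOn (u_ K) tphi)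
  (enorm_gradB_LpOn u (u_ K)) (enorm_gradient_testB_LpOn u tphi).
apply: le_trans (h1 _) (fin _ _ phi2 _).
  move=> x _; apply: ler_norm_enorm.
  rewrite -(enormN (grad u x - _)) opprB.
  by apply: le_trans (enormD _ _); rewrite addrA subrK.
by rewrite (le_trans (Gu' K))// ler_wpM2r ?(ltW (rate_gt0 _ _))// lerDl.
Qed.

End sobolev_completeness.

(** * The energy functional and its minimizers *)

Lemma mean_sub_le (R : realFieldType) (a b c m r : R) :
  m <= c -> a <= m + r -> b <= m + r -> (a + b) / 2 - c <= r.
Proof. lra. Qed.

Section obstacle.
Context (R : realType) (N : nat) (p : R) (Omega : set 'rV[R]_N).
Context (p1 : 1 < p) (N0 : (0 < N)%N).
Context (oO : open Omega) (bO : bounded_set Omega).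
Local Notation mu := (lebesgue_rV R N).
Local Notation E := (energy mu Omega p).
Local Notation L := (LpOn mu Omega p).
Local Notation W := (sobolev p Omega).
Local Notation q := (p / (p - 1)).
Context (psi f : 'rV[R]_N -> R).
Context (Lf : LpOn mu Omega q f).
Implicit Types (u v w : sobolev p Omega).

Let p0 : 0 < p. Proof. by rewrite (lt_trans ltr01). Qed.
Let mO : measurable Omega. Proof. exact: open_measurable_rV. Qed.
Let q0 : 0 < q. Proof. exact: conjugate_gt0. Qed.
Let pq : p^-1 + q^-1 = 1.
Proof. exact: inv_conjugate. Qed.

Local Notation K := (@obstacle_set R N p Omega psi).
Local Notation F u := (fun x => enorm (grad u x)).

Lemma integrable_load (g : 'rV[R]_N -> R) : L g ->
  mu.-integrable Omega (EFin \o (fun x => f x * g x)).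
Proof.
move=> Lg; apply: (integrable_pairing mO p0 q0 pq Lg Lf).
  by apply: measurable_funM; [case: Lf|case: Lg].
by move=> x _; rewrite normrM mulrC.
Qed.

Lemma LpOn_powR (A : 'rV[R]_N -> R) : L A ->
  LpOn mu Omega q (fun x => `|A x| `^ (p - 1)).
Proof.
move=> [mA IA]; split; first exact: measurable_powR_normr.
apply: eq_integrable IA => // x _.
rewrite (ger0_norm (powR_ge0 _ _)) -powRrM; congr (_ `^ _)%:E.
by field; rewrite gt_eqF// subr_gt0.
Qed.

Lemma measurable_pflux u i :
  measurable_fun Omega (fun x => pflux p (grad u x) ord0 i).
Proof.
under eq_fun do rewrite mxE.
have [mG _] := enorm_grad_LpOn p1 oO u; have [mi _] := grad_LpOn p1 oO u i.
apply: measurable_funM => //.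
exact: (@measurableT_comp _ _ _ _ _ _ (@powR R ^~ (p - 2))).
Qed.

Lemma pflux_LpOn u : LpOn mu Omega q (fun x => enorm (pflux p (grad u x))).
Proof.
have := LpOn_powR (enorm_grad_LpOn p1 oO u).
by under eq_fun do rewrite ger0_norm ?enorm_ge0// -enorm_pflux//.
Qed.

Lemma measurable_flux_work u v w :
  measurable_fun Omega (fun x => edot (pflux p (grad u x)) (grad v x - grad w x)).
Proof.
apply: measurable_edot => i; first exact: measurable_pflux.
by case: (gradB_LpOn p1 oO v w i).
Qed.

Let flux_work_le u v w x : Omega x ->
  `|edot (pflux p (grad u x)) (grad v x - grad w x)| <=
  `|enorm (grad v x - grad w x)| * `|enorm (pflux p (grad u x))|.
Proof. by move=> _; rewrite mulrC !(ger0_norm (enorm_ge0 _)) normr_edot. Qed.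

Lemma integrable_flux_work u v w :
  mu.-integrable Omega (EFin \o (fun x => edot (pflux p (grad u x)) (grad v x - grad w x))).
Proof.
apply: (integrable_pairing mO p0 q0 pq (enorm_gradB_LpOn p1 oO v w) (pflux_LpOn u)).
  exact: measurable_flux_work.
exact: flux_work_le.
Qed.

(** The functional of which the variational inequality is the Euler-Lagrange
    condition on the convex set of admissible functions. *)
Definition obstacle_energy u : R :=
  p^-1 * E (F u) - \int[mu]_(x in Omega) (f x * u x).
Local Notation J := obstacle_energy.

(** The integrated subgradient inequality. It stands in for both the derivative
    and the lower semicontinuity of the functional. *)
Lemma obstacle_energy_subgradient u v :
  J u + \int[mu]_(x in Omega) edot (pflux p (grad u x)) (grad v x - grad u x) -
  \int[mu]_(x in Omega) (f x * (v x - u x)) <= J v.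
Proof.
have Iu := integrable_load (sobolev_LpOn p1 oO u).
have Iv := integrable_load (sobolev_LpOn p1 oO v).
have Iw := integrable_flux_work u v u.
have [_ IFu] := enorm_grad_LpOn p1 oO u; have [_ IFv] := enorm_grad_LpOn p1 oO v.
have -> : \int[mu]_(x in Omega) (f x * (v x - u x)) =
    \int[mu]_(x in Omega) (f x * v x) - \int[mu]_(x in Omega) (f x * u x).
  by rewrite -RintegralB//; apply: eq_Rintegral => x _; rewrite mulrBr.
have : E (F u) + p * \int[mu]_(x in Omega)
    edot (pflux p (grad u x)) (grad v x - grad u x) <= E (F v).
  rewrite -RintegralZl// -RintegralD//; last exact: integrable_EFinZ.
  apply: le_Rintegral => //; first by apply: integrable_EFinD => //; exact: integrable_EFinZ.
  by move=> x _; rewrite !(ger0_norm (enorm_ge0 _)); exact: pflux_subgradient.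
rewrite -(ler_pM2l (_ : 0 < p^-1)) ?invr_gt0// mulrDr mulrA mulVf ?gt_eqF// mul1r.
rewrite /J; move: (E (F u)) (E (F v)) => eu ev.
move: (Rintegral _ _ _) (Rintegral _ _ _) (Rintegral _ _ _) => i1 i2 i3; lra.
Qed.

(** The load is linear and cancels at the midpoint; only the convexity deficit
    of the gradient term remains. *)
Lemma obstacle_energy_midpoint (e : R) : 0 < e -> exists2 C : R, 0 < C &
  forall u v w, sobolev_fun w = (fun x => 2^-1 * u x + 2^-1 * v x) ->
    grad w = (fun x => 2^-1 *: grad u x + 2^-1 *: grad v x) ->
    E (fun x => enorm (grad u x - grad v x)) <=
    e * (E (F u) + E (F v)) + C * ((J u + J v) / 2 - J w).
Proof.
move=> e0; have [C C0 gap] := @uniform_convexity R N p p1 e e0.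
exists (C * p); first exact: mulr_gt0.
move=> u v w wE GE.
have Iu := integrable_load (sobolev_LpOn p1 oO u).
have Iv := integrable_load (sobolev_LpOn p1 oO v).
have [_ IFu] := enorm_grad_LpOn p1 oO u; have [_ IFv] := enorm_grad_LpOn p1 oO v.
have [_ IFw] := enorm_grad_LpOn p1 oO w.
have [_ IFuv] := enorm_gradB_LpOn p1 oO u v.
have loadE : \int[mu]_(x in Omega) (f x * w x) =
    2^-1 * \int[mu]_(x in Omega) (f x * u x) + 2^-1 * \int[mu]_(x in Omega) (f x * v x).
  rewrite -!RintegralZl// -RintegralD//; try exact: integrable_EFinZ.
  by apply: eq_Rintegral => x _; rewrite wE mulrDr !mulrA ![f x * _]mulrC.
have -> : C * p * ((J u + J v) / 2 - J w) = C / 2 * (E (F u) + E (F v)) + (- C) * E (F w).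
  rewrite /J loadE; move: (Rintegral _ _ _) (Rintegral _ _ _) => i1 i2.
  by move: (E (F u)) (E (F v)) (E (F w)) => eu ev ew; field; rewrite gt_eqF.
apply: le_trans (@le_Rintegral_lin3 _ _ _ mu _ mO (e + C / 2) (e + C / 2) (- C)
  _ _ _ _ IFu IFv IFw IFuv _) _.
  move=> x _; rewrite !(ger0_norm (enorm_ge0 _)) GE.
  apply: le_trans (gap _ _) _; rewrite /midpoint_gap scalerDr.
  by move: (_ `^ p) (_ `^ p) (_ `^ p) => x1 x2 x3; lra.
rewrite -/(E (F u)) -/(E (F v)) -/(E (F w)).
by move: (E (F u)) (E (F v)) (E (F w)) => x1 x2 x3; lra.
Qed.

(** By the Poincare inequality and Young's inequality the load is absorbed by
    one half of the gradient term, up to a constant. *)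
Lemma obstacle_energy_coercive : exists B : R,
  forall u, W0 u -> E (F u) <= 2 * p * (J u + B).
Proof.
have [C C0 poincare] := poincare_W0 p1 N0 oO bO.
(* with this [c], the load takes up half of the gradient term *)
pose c : R := (2 * p * C)^-1.
have c0 : 0 < c by rewrite invr_gt0 !mulr_gt0.
pose l := c `^ p^-1; have l0 : 0 < l by exact: powR_gt0.
have lp : l `^ p = c by rewrite -powRrM mulVf ?gt_eqF// powRr1// ltW.
exists (l^-1 `^ q * energy mu Omega q f) => u Wu.
have Lu := sobolev_LpOn p1 oO u.
have : `|\int[mu]_(x in Omega) (f x * u x)| <= l `^ p * E u + l^-1 `^ q * energy mu Omega q f.
  apply: (pairing_le mO p0 q0 pq l0 Lu Lf).
    by apply: measurable_funM; [case: Lf|case: Lu].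
  by move=> x _; rewrite normrM mulrC.
move=> /(le_trans (ler_norm _)); rewrite lp /J.
have := poincare u Wu.
move: (E u) (E (F u)) (Rintegral _ _ _) (l^-1 `^ q * _) => eu eF i1 i2 h1 h2.
have cE : c * eu <= c * (C * eF) by rewrite ler_pM2l.
have cCE : c * (C * eF) = p^-1 * eF / 2 by rewrite /c; field; rewrite !gt_eqF.
have -> : eF = 2 * p * (p^-1 * eF / 2) by field; rewrite gt_eqF.
rewrite ler_pM2l ?mulr_gt0//.
have -> : p^-1 * (2 * p * (p^-1 * eF / 2)) = p^-1 * eF by field; rewrite gt_eqF.
lra.
Qed.

Lemma obstacle_set_convex (a b : R) u v w : 0 <= a -> 0 <= b -> a + b = 1 ->
  K u -> K v -> sobolev_fun w = (fun x => a * u x + b * v x) ->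
  grad w = (fun x => a *: grad u x + b *: grad v x) -> K w.
Proof.
move=> a0 b0 ab [Wu psiu] [Wv psiv] wE GE; split; first exact: (W0_lin p1 oO bO Wu Wv wE GE).
apply: filterS2 psiu psiv => x psiu psiv Ox.
rewrite wE -[psi x]mul1r -ab mulrDl lerD// ler_wpM2l//; [exact: psiu|exact: psiv].
Qed.

(** The midpoint of two admissible functions is admissible, so its energy is at
    least [m]; uniform convexity then makes the two gradients close. *)
Lemma near_minimizers_close (m e : R) : (forall w, K w -> m <= J w) -> 0 < e ->
  exists2 r : R, 0 < r & forall u v, K u -> K v -> J u <= m + r -> J v <= m + r ->
    E (fun x => enorm (grad u x - grad v x)) <= e.
Proof.
move=> mJ e0; have [B coercive] := obstacle_energy_coercive.
pose M := `|2 * p * (m + 1 + B)| + 1.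
have M0 : 0 < M by rewrite ltr_wpDl.
have e'0 : 0 < e / (4 * M) by rewrite divr_gt0// mulr_gt0.
have [C C0 mid] := obstacle_energy_midpoint e'0.
exists (Num.min 1 (e / (2 * C))).
  by rewrite lt_min ltr01 divr_gt0// mulr_gt0.
move=> u v Ku Kv; rewrite !addr_minr !le_min => /andP[u1 u2] /andP[v1 v2].
have half0 : 0 <= 2^-1 :> R by rewrite invr_ge0.
have half2 : 2^-1 + 2^-1 = 1 :> R by lra.
have [w [wE GE]] := sobolev_lin p1 oO bO 2^-1 2^-1 u v.
have mw := mJ w (obstacle_set_convex half0 half0 half2 Ku Kv wE GE).
have bound z : K z -> J z <= m + 1 -> E (F z) <= M.
  move=> [Wz _] z1; apply: le_trans (coercive z Wz) _.
  apply: (@le_trans _ _ (2 * p * (m + 1 + B))).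
    by rewrite ler_pM2l ?mulr_gt0// lerD2r.
  by rewrite (le_trans (ler_norm _))// lerDl.
apply: le_trans (mid u v w wE GE) _.
have h1 : e / (4 * M) * (E (F u) + E (F v)) <= e / (4 * M) * (M + M).
  by rewrite ler_pM2l// lerD// bound.
have h2 : C * ((J u + J v) / 2 - J w) <= C * (e / (2 * C)).
  rewrite ler_pM2l//.
  exact: mean_sub_le mw u2 v2.
have eE : e = e / (4 * M) * (M + M) + C * (e / (2 * C)).
  by field; rewrite !gt_eqF.
by rewrite [leRHS]eE; exact: lerD.
Qed.

(** The subgradient inequality at the points [w n] of the segment from [u] to
    [v], combined with the minimality of [u], bounds the load by the work of
    the flux of [w n]; the flux of [u] is reached by dominated convergence. *)
Lemma minimizer_solves u : K u -> (forall v, K v -> J u <= J v) ->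
  obstacle_solution f psi u.
Proof.
move=> Ku umin; split => // v Kv.
pose t (n : nat) : R := n.+1%:R^-1.
have t0 n : 0 < t n by rewrite invr_gt0.
have t1 n : t n <= 1 by rewrite invf_le1// ler1n.
have /choice[w wP] : forall n, exists w : W,
    sobolev_fun w = (fun x => (1 - t n) * u x + t n * v x) /\
    grad w = (fun x => (1 - t n) *: grad u x + t n *: grad v x).
  by move=> n; exact: sobolev_lin.
have Kw n : K (w n).
  have [wE GE] := wP n.
  by apply: (obstacle_set_convex _ _ _ Ku Kv wE GE); rewrite ?subrK ?subr_ge0// ltW.
pose H x := grad v x - grad u x.
have GwE n x : grad (w n) x = grad u x + t n *: H x.
  by have [_ ->] := wP n; rewrite scalerBl scale1r scalerBr addrAC -addrA.
have le_work n : \int[mu]_(x in Omega) (f x * (v x - u x)) <=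
    \int[mu]_(x in Omega) edot (pflux p (grad (w n) x)) (H x).
  have := le_trans (obstacle_energy_subgradient (w n) u) (umin _ (Kw n)).
  have -> : \int[mu]_(x in Omega) edot (pflux p (grad (w n) x)) (grad u x - grad (w n) x) =
      - t n * \int[mu]_(x in Omega) edot (pflux p (grad (w n) x)) (H x).
    rewrite -RintegralZl//; last exact: integrable_flux_work.
    apply: eq_Rintegral => x _; rewrite GwE opprD addNKr.
    by rewrite edotNr edotZr mulNr.
  have -> : \int[mu]_(x in Omega) (f x * (u x - w n x)) =
      - t n * \int[mu]_(x in Omega) (f x * (v x - u x)).
    rewrite -RintegralZl//; last first.
      by apply: integrable_load; apply: LpOnB => //; exact: sobolev_LpOn.
    apply: eq_Rintegral => x _; have [-> _] := wP n; ring.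
  rewrite -addrA gerDl -mulrBr mulNr oppr_le0 pmulr_rge0// subr_ge0//.
pose A x := enorm (grad u x) + enorm (grad v x).
have A0 x : 0 <= A x by rewrite addr_ge0 ?enorm_ge0.
have LA : L A by apply: LpOnD => //; exact: enorm_grad_LpOn.
pose dom x := `|A x| `^ (p - 1) * enorm (H x).
have Idom : mu.-integrable Omega (EFin \o dom).
  have LH := enorm_gradB_LpOn p1 oO v u; have LAp := LpOn_powR LA.
  apply: (integrable_pairing mO p0 q0 pq LH LAp).
    by apply: measurable_funM; [case: LAp|case: LH].
  by move=> x _; rewrite normrM mulrC.
have work_cvg_ae : {ae mu, forall x, Omega x ->
    (edot (pflux p (grad (w n) x)) (H x))%:E @[n --> \oo] -->
    (edot (pflux p (grad u x)) (H x))%:E}.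
  apply: aeW => x _; apply: cvg_EFin; first exact: nearW.
  have Gw_cvg : grad (w n) x @[n --> \oo] --> grad u x.
    have -> : (fun n => grad (w n) x) = fun n => grad u x + t n *: H x.
      by apply/funext => n; exact: GwE.
    have {2}-> : grad u x = grad u x + 0 *: H x by rewrite scale0r addr0.
    apply: cvgD; first exact: cvg_cst.
    apply: cvgZr_tmp; exact: cvg_harmonic.
  have := @cvg_pflux R N p p1 nat \oo _ (fun n => grad (w n) x) (grad u x) (H x) Gw_cvg.
  exact.
have work_dom : {ae mu, forall x n, Omega x ->
    (`|(edot (pflux p (grad (w n) x)) (H x))%:E| <= (EFin \o dom) x)%E}.
  apply: aeW => x n _; rewrite lee_fin (le_trans (normr_edot _ _))//.
  rewrite ler_wpM2r ?enorm_ge0// enorm_pflux// ge0_ler_powR ?nnegrE ?enorm_ge0//.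
    by rewrite subr_ge0 ltW.
  rewrite ger0_norm//; have [_ ->] := wP n; rewrite (le_trans (enormD _ _))//.
  rewrite !enormZ !ger0_norm ?subr_ge0// ?(ltW (t0 n))// lerD// ler_piMl ?enorm_ge0//.
  by rewrite gerBl ltW.
have mw n : measurable_fun Omega (fun x => (edot (pflux p (grad (w n) x)) (H x))%:E).
  by apply/measurable_EFinP; exact: measurable_flux_work.
have mu_ : measurable_fun Omega (fun x => (edot (pflux p (grad u x)) (H x))%:E).
  by apply/measurable_EFinP; exact: measurable_flux_work.
have [_ _ work_cvg] := dominated_convergence mO mw mu_ work_cvg_ae Idom work_dom.
rewrite -lee_fin [leRHS](EFin_Rintegral mO (integrable_flux_work u v u)).
rewrite -(cvg_lim _ work_cvg)//; apply: lime_ge; first exact: (cvgP _ work_cvg).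
apply: nearW => n; have work_n := le_work n.
rewrite -lee_fin [leRHS](EFin_Rintegral mO (integrable_flux_work (w n) v u)) in work_n.
exact: work_n.
Qed.

(** The variational inequality says exactly that the linear part of the
    subgradient inequality is nonnegative. *)
Lemma solution_minimizes u : obstacle_solution f psi u ->
  K u /\ forall v, K v -> J u <= J v.
Proof.
move=> [Ku uVI]; split => // v Kv; have := uVI v Kv.
by have := obstacle_energy_subgradient u v; lra.
Qed.

Lemma poincare_diff : exists2 C : R, 0 < C & forall u v, W0 u -> W0 v ->
  E (fun x => u x - v x) <= C * E (fun x => enorm (grad u x - grad v x)).
Proof.
have [C C0 poincare] := poincare_W0 p1 N0 oO bO; exists C => // u v Wu Wv.
have [w [wE GE]] := sobolev_lin p1 oO bO 1 (-1) u v.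
have -> : (fun x => u x - v x) = w.
  by rewrite wE; apply/funext => x; rewrite mul1r mulN1r.
have -> : (fun x => enorm (grad u x - grad v x)) = F w.
  by rewrite GE; apply/funext => x; rewrite scale1r scaleN1r.
exact: poincare w (W0_lin p1 oO bO Wu Wv wE GE).
Qed.

Lemma minimizer_unique u v : K u -> (forall w, K w -> J u <= J w) ->
  K v -> (forall w, K w -> J v <= J w) -> v = u %[ae mu in Omega].
Proof.
move=> Ku umin Kv vmin; have [C C0 poincare] := poincare_diff.
have G0 : E (fun x => enorm (grad v x - grad u x)) <= 0.
  apply/ler_addgt0Pr => e e0; rewrite add0r.
  have [r r0 close] := near_minimizers_close umin e0.
  apply: close => //; last by rewrite lerDl ltW.
  by rewrite (le_trans (vmin u Ku))// lerDl ltW.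
have uv0 : E (fun x => v x - u x) = 0.
  apply/eqP; rewrite eq_le energy_ge0 andbT.
  apply: le_trans (poincare _ _ Kv.1 Ku.1) _.
  by rewrite pmulr_rle0.
have Luv : L (fun x => v x - u x) by apply: LpOnB => //; exact: sobolev_LpOn.
have := energy_eq0 mO p0 Luv uv0; apply: filterS => x h Ox.
by apply/eqP; rewrite -subr_eq0 h.
Qed.

(** Near minimizers with summably small defects form a fast Cauchy sequence, by
    [near_minimizers_close] for the gradients and by the Poincare inequality
    for the functions. The subgradient inequality at the limit [u], whose
    linear part tends to [0] along the sequence, shows that [u] attains the
    infimum. *)
Lemma minimizer_exists : K !=set0 -> exists u, K u /\ forall v, K v -> J u <= J v.
Proof.
move=> [v0 Kv0]; have [B coercive] := obstacle_energy_coercive.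
have [C C0 poincare] := poincare_diff.
pose m := inf [set J v | v in K].
have lbJ : has_lbound [set J v | v in K].
  exists (- B) => _ [v [Wv _] <-]; have := le_trans (energy_ge0 _ _ _ _) (coercive v Wv).
  by rewrite pmulr_rge0 ?mulr_gt0//; lra.
have hiJ : has_inf [set J v | v in K] by split => //; exists (J v0), v0.
have mJ v : K v -> m <= J v by move=> Kv; apply: ge_inf => //; exists v.
have /choice[r rP] : forall k, exists r : R, 0 < r /\ forall u v, K u -> K v ->
    J u <= m + r -> J v <= m + r ->
    E (fun x => enorm (grad u x - grad v x)) <= rate p k / (1 + C).
  move=> k; have e0 : 0 < rate p k / (1 + C) by rewrite divr_gt0 ?rate_gt0// addr_gt0.
  by have [r r0 close] := near_minimizers_close mJ e0; exists r.
(* minimizing over [i <= k] makes the defect [s l] usable at every stage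
   [k <= l]; the initial value forces the defects to tend to [0] *)
pose s k : R := \big[Num.min/k.+1%:R^-1]_(i < k.+1) r i.
have s0 k : 0 < s k.
  by apply/bigmin_gtP; split => [|i _]; [rewrite invr_gt0|case: (rP i)].
have s_le k l : (k <= l)%N -> s l <= r k.
  move=> kl; have kl' : (k < l.+1)%N by [].
  exact: (@bigmin_le _ _ _ _ (Ordinal kl') (fun i : 'I_l.+1 => r i)).
have /choice[v_ vP] : forall k, exists v, K v /\ J v <= m + s k.
  move=> k; have [_ [v Kv <-] /ltW vk] := inf_adherent (s0 k) hiJ.
  by exists v.
have close k l : (k <= l)%N ->
    E (fun x => enorm (grad (v_ k) x - grad (v_ l) x)) <= rate p k / (1 + C).
  move=> kl; have [[Kk Jk] [Kl Jl]] := (vP k, vP l).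
  apply: (rP k).2 => //.
    by rewrite (le_trans Jk)// lerD2l s_le.
  by rewrite (le_trans Jl)// lerD2l s_le.
have C1 : 0 < 1 + C by rewrite addr_gt0.
have vG k l : (k <= l)%N ->
    E (fun x => enorm (grad (v_ k) x - grad (v_ l) x)) <= rate p k.
  move=> kl; apply: le_trans (close k l kl) _.
  by rewrite ler_pdivrMr// ler_peMr ?(ltW (rate_gt0 _ _))// lerDl ltW.
have vf k l : (k <= l)%N -> E (fun x => v_ k x - v_ l x) <= rate p k.
  move=> kl; apply: le_trans (poincare _ _ (vP k).1.1 (vP l).1.1) _.
  apply: (@le_trans _ _ (C * (rate p k / (1 + C)))); first by rewrite ler_pM2l// close.
  by rewrite mulrA ler_pdivrMr// mulrC ler_pM2l ?rate_gt0// lerDr.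
have [u [Wu uf uG u_ae]] := sobolev_complete p1 oO bO (fun k => (vP k).1.1) vf vG.
have Ku : K u.
  split => //; have : {ae mu, forall x, forall k, Omega x -> psi x <= v_ k x}.
    by apply/ae_foralln => k; exact: (vP k).1.2.
  move=> psiv; apply: filterS2 psiv u_ae => x psiv u_cvg Ox.
  by apply: cvgr_to_ge (u_cvg Ox) _; apply: nearW => k; exact: psiv.
exists u; split => // v Kv; apply: le_trans (mJ v Kv).
apply/ler_addgt0Pr => e e0.
have e30 : 0 < e / 3 by rewrite divr_gt0.
have [r1 r10 small1] := pairing_small mO p0 q0 pq (pflux_LpOn u) e30.
have [r2 r20 small2] := pairing_small mO p0 q0 pq Lf e30.
pose M : R := (2 `^ p) ^+ N * N%:R + 1.
have M1 : 0 <= (2 `^ p) ^+ N * N%:R :> R by rewrite mulr_ge0 ?exprn_ge0 ?powR_ge0.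
have M0 : 0 < M by rewrite ltr_wpDl.
have r0 : 0 < Num.min r1 r2 / M by rewrite divr_gt0// lt_min r10.
have [k1 k1P] := rate_small p0 r0.
have [k2 _ k2P] := near_infty_natSinv_lt (PosNum e30).
pose k := maxn k1 k2.
have fk : rate p k * M <= Num.min r1 r2 by rewrite -ler_pdivlMr// k1P// leq_maxl.
have f0 := ltW (rate_gt0 p k).
have sk : s k <= e / 3.
  apply: (@le_trans _ _ k.+1%:R^-1); first exact: bigmin_le_id.
  by apply: ltW; apply: (k2P k); rewrite /= leq_maxr.
have := obstacle_energy_subgradient u (v_ k).
have : `|\int[mu]_(x in Omega) edot (pflux p (grad u x)) (grad (v_ k) x - grad u x)| <= e / 3.
  apply: (small1 (fun x => enorm (grad (v_ k) x - grad u x))).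
  - exact: enorm_gradB_LpOn.
  - have -> : E (fun x => enorm (grad (v_ k) x - grad u x)) =
        E (fun x => enorm (grad u x - grad (v_ k) x)).
      by apply: eq_Rintegral => x _; rewrite -enormN opprB.
    rewrite (le_trans (uG k))// (@le_trans _ _ (rate p k * M))//.
      by rewrite mulrC ler_wpM2l// lerDl.
    by rewrite (le_trans fk)// ge_min lexx.
  - exact: measurable_flux_work.
  - exact: flux_work_le.
have : `|\int[mu]_(x in Omega) (f x * (v_ k x - u x))| <= e / 3.
  have Lvu : L (fun x => v_ k x - u x) by apply: LpOnB => //; exact: sobolev_LpOn.
  apply: (small2 (fun x => v_ k x - u x)) => //.
  - rewrite energy_distC (le_trans (uf k))// (@le_trans _ _ (rate p k * M))//.
      by rewrite ler_peMr// lerDr.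
    by rewrite (le_trans fk)// ge_min lexx orbT.
  - by apply: measurable_funM; [case: Lf|case: Lvu].
  - by move=> x _; rewrite normrM mulrC.
rewrite !ler_norml => /andP[h1 h2] /andP[h3 h4].
have := (vP k).2.
move: (J u) (J _) (Rintegral _ _ _) (Rintegral _ _ _) h1 h2 h3 h4 => j1 j2 i1 i2; lra.
Qed.

End obstacle.

Theorem proposition3 (R : realType) (N : nat) (p : R) (Omega : set 'rV[R]_N)
    (psi : sobolev p Omega) (f : 'rV[R]_N -> R) :
  (2 <= N)%N -> 1 < p ->
  domain Omega -> bounded_set Omega -> piecewise_C1_boundary Omega ->
  W0 psi -> Lp (hoelder_conjugate p%:E) Omega f ->
  exists u : sobolev p Omega, obstacle_solution f psi u /\
    forall v : sobolev p Omega, obstacle_solution f psi v ->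
      v = u %[ae lebesgue_rV R N in Omega].
Proof.
move=> N2 p1 [oO _ _] bO _ Wpsi Lf.
have N0 : (0 < N)%N by exact: leq_trans N2.
have mO := open_measurable_rV oO.
have qE : hoelder_conjugate p%:E = (p / (p - 1))%:E :> \bar R.
  rewrite /hoelder_conjugate/= eqe gt_eqF ?(lt_trans ltr01)//.
  by rewrite -EFinD inver subr_eq0 gt_eqF// -EFinM.
have {}Lf : LpOn (lebesgue_rV R N) Omega (p / (p - 1)) f.
  apply/LpP => //; last by rewrite -qE.
  by rewrite ler_pdivlMr ?subr_gt0// mul1r gerBl.
have [|u [Ku umin]] := minimizer_exists (psi := psi) p1 N0 oO bO Lf.
  by exists psi; split => //; apply: nearW => x _; exact: lexx.
exists u; split; first exact: (minimizer_solves p1 oO bO Lf Ku umin).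
move=> v /(solution_minimizes p1 oO Lf)[Kv vmin].
exact: (minimizer_unique p1 N0 oO bO Lf Ku umin Kv vmin).
Qed.
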